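(* Let $q$ be a prime power, let $n \geq 5$ be an integer and let $S \subset \mathbb{F}_q^n$. Let $\tau > 0$ be a real number and $\delta \in (0,1)$ such that $$q \geq 32\max\left(\frac{n(1+\tau)}{(\tau\delta)^2},\, n\right).$$ Suppose $q^r < |S| \leq q^{r+1}$ for some integer $4 \leq r \leq n-1$, and let $t = r-3$. Then at least a $(1-\delta)$-fraction of all surjective linear maps $L : \mathbb{F}_q^n \to \mathbb{F}_q^t$ are such that $L(U_S)$ is $\tau/q^t$-close to the uniform distribution in the $\ell_\infty$ norm, i.e. for every $y \in \mathbb{F}_q^t$, $$\left|\Pr[L(U_S) = y] - q^{-t}\right| \leq \tau q^{-t}.$$
   Context: $U_S$ denotes a random variable distributed uniformly on the finite set $S$. A random variable $X$ on a finite set $Y$ is said to be $\epsilon$-close to uniform in the $\ell_\infty$ norm if $|\Pr[X=y] - 1/|Y|| \leq \epsilon$ for every $y \in Y$. *)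

(* Defs.v *)
From HB Require Import structures.
From mathcomp Require Import all_boot all_order all_algebra all_field.
From mathcomp Require Import all_classical all_reals.
Set Implicit Arguments. Unset Strict Implicit. Unset Printing Implicit Defensive.
Import Order.TTheory GRing.Theory Num.Theory.
Local Open Scope ring_scope.

Definition prob_img (R : realType) (F : finFieldType) (n t : nat)
  (S : {set 'rV[F]_n}) (L : 'M[F]_(n, t)) (y : 'rV[F]_t) : R :=
  (#|[set x in S | x *m L == y]|)%:R / (#|S|)%:R.

Definition surjective_lin (F : finFieldType) (n t : nat) (L : 'M[F]_(n, t)) : bool :=
  [forall y : 'rV[F]_t, exists x : 'rV[F]_n, x *m L == y].

Definition close_to_uniform (R : realType) (F : finFieldType) (n t : nat)
  (S : {set 'rV[F]_n}) (L : 'M[F]_(n, t)) (eps : R) : Prop :=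
  forall y : 'rV[F]_t, `|prob_img R S L y - (#|'rV[F]_t|%:R)^-1| <= eps.

(* Main.v *)
Require Import Defs.
From HB Require Import structures.
From mathcomp Require Import all_boot all_order all_algebra all_field.
From mathcomp Require Import ssrcomplements mpoly.
From mathcomp Require Import all_classical all_reals.
From mathcomp Require Import zify ring lra.
Set Implicit Arguments. Unset Strict Implicit. Unset Printing Implicit Defensive.
Import Order.TTheory GRing.Theory Num.Theory.
Local Open Scope ring_scope.

(* Let [q = #|F|] and [t = r - 3], so that [mu = |S| / q^(t+2)] exceeds [q].
   If a map [L] to [F^t] is unbalanced at [y], then by Chebyshev's inequality two
   random further coordinates [C] split the fiber of [L] over [y] into [q^2] cells,
   almost all of which have a size far from [mu]: the set of points of [F^(t+2)]
   over which the map [x |-> (x C, x L)] has an abnormal fiber almost contains a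
   plane.  Up to a change of basis of [F^(t+2)], the direction of this plane is
   arbitrary.  On the other hand Chebyshev's inequality for the map to [F^(t+2)]
   says that its set of abnormal points has density [O(1 / (tau^2 q))] on average.
   If a proportion [delta] of the maps to [F^t] were unbalanced, the union of the
   abnormal sets of [O(1 / delta)] maps to [F^(t+2)] would almost contain a plane in
   half of all directions and still have small density.  This contradicts the
   Kakeya bound of Kopparty, Lev, Saraf and Sudan for planes: the loss in the method
   of multiplicities is only [(1 + O(1/q))^-n], bounded below because [q >= 32 n]. *)

(** * Hasse derivatives of multivariate polynomials *)

Section HasseDerivative.
Variables (n : nat) (R : comNzRingType).
Implicit Types (p : {mpoly R[n]}) (i e : 'X_{1..n}).

Definition mbin i e : nat := (\prod_j 'C(e j, i j))%N.

(** Divided derivatives, which detect orders of vanishing in every characteristic. The subtraction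
    [e - i] is truncated, but [mbin i e] is zero unless [i <= e]. *)
Definition hasse i p : {mpoly R[n]} :=
  \sum_(e <- msupp p) (p@_e *+ mbin i e) *: 'X_[e - i].

Lemma hassewE i p k : (msize p <= k)%N ->
  hasse i p = \sum_(e : 'X_{1..n < k}) (p@_e *+ mbin i e) *: 'X_[e - i].
Proof.
move=> le_pk; rewrite /hasse (big_mksub ('X_{1..n < k})) ?msupp_uniq //=; first last.
  by move=> x /msize_mdeg_lt /leq_trans; apply.
by rewrite big_rmcond //= => e /memN_msupp_eq0 ->; rewrite mul0rn scale0r.
Qed.

Lemma mbin_gt0 i e : (0 < mbin i e)%N = (i <= e)%MM.
Proof.
apply/idP/mnm_lepP => [h j|h]; last by rewrite prodn_gt0 // => j; rewrite bin_gt0.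
rewrite leqNgt; apply/negP => lt; move: h.
by rewrite /mbin (bigD1 j) //= bin_small // mul0n.
Qed.

Lemma mbinNle i e : ~~ (i <= e)%MM -> mbin i e = 0%N.
Proof. by rewrite -mbin_gt0 lt0n negbK => /eqP. Qed.

Lemma mcoeff_hasse i p e : (hasse i p)@_e = p@_(e + i) *+ mbin i (e + i).
Proof.
rewrite /hasse raddf_sum /=.
have [h|h] := boolP ((e + i)%MM \in msupp p); last first.
  rewrite (memN_msupp_eq0 h) mul0rn big_seq big1 // => e' he'.
  rewrite mcoeffZ mcoeffX; case: eqP => [E|_]; last by rewrite mulr0.
  have [le|nle] := boolP (i <= e')%MM; last by rewrite mbinNle // mulr0n mul0r.
  by move: h; rewrite -E submK // he'.
rewrite (bigD1_seq _ h) ?msupp_uniq //= big1 ?addr0.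
  by rewrite mcoeffZ mcoeffX addmK eqxx mulr1.
move=> e' ne; rewrite mcoeffZ mcoeffX; case: eqP => [E|_]; last by rewrite mulr0.
have [le|nle] := boolP (i <= e')%MM; last by rewrite mbinNle // mulr0n mul0r.
by move: ne; rewrite -E submK // eqxx.
Qed.

Lemma mmap_hasse (S : comNzRingType) (f : {rmorphism R -> S}) h i p k :
  (msize p <= k)%N ->
  mmap f h (hasse i p) =
    \sum_(e : 'X_{1..n < k}) (f p@_e *+ mbin i e) * mmap1 h (e - i)%MM.
Proof.
move=> le; rewrite (hassewE _ le) raddf_sum; apply: eq_bigr => e _ /=.
by rewrite mmapZ mmapX rmorphMn.
Qed.

Lemma msize_hasse i p : (msize (hasse i p) <= msize p)%N.
Proof.
rewrite msizeE; apply/bigmax_leqP_seq => e; rewrite mcoeff_msupp mcoeff_hasse => h _.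
have /msize_mdeg_lt : (e + i)%MM \in msupp p.
  by rewrite mcoeff_msupp; apply: contraNneq h => ->; rewrite mul0rn.
by rewrite mdegD => /(leq_ltn_trans (leq_addr _ _)).
Qed.

(** Coordinatewise, both sides are the trinomial coefficient [(a + b + c)! / (a! b! c!)]. *)
Lemma mbin_comp i j e :
  (mbin i (e + j + i) * mbin j (e + j) = mbin (j + i) (e + (j + i)) * mbin i (j + i))%N.
Proof.
rewrite /mbin -!big_split /=; apply: eq_bigr => l _; rewrite !mnmDE.
have key a b c : ('C(a + b + c, c) * 'C(a + b, b) = 'C(a + (b + c), b + c) * 'C(b + c, c))%N.
  have f0 := fact_gt0.
  apply/eqP; rewrite -(eqn_pmul2r (f0 a)) -(eqn_pmul2r (f0 b)) -(eqn_pmul2r (f0 c)).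
  have := @bin_fact (a + b + c) c; rewrite leq_addl addnK => /(_ isT) e1.
  have := @bin_fact (a + b) b; rewrite leq_addl addnK => /(_ isT) e2.
  have := @bin_fact (a + (b + c)) (b + c); rewrite leq_addl addnK => /(_ isT) e3.
  have := @bin_fact (b + c) c; rewrite leq_addl addnK => /(_ isT) e4.
  apply/eqP; transitivity ((a + b + c)`!).
    rewrite -e1 -e2; lia.
  rewrite -addnA -e3 -e4; lia.
exact: key.
Qed.

Lemma hasse_hasse i j p : hasse j (hasse i p) = hasse (j + i) p *+ mbin i (j + i).
Proof.
apply/mpolyP => e; rewrite mcoeffMn !mcoeff_hasse -!mulrnA mbin_comp.
by rewrite addmA.
Qed.

(* Taylor's formula; the sum over [phi] runs over a box that contains every exponent of [p]. *)
Lemma mmap_taylor (S : comNzRingType) (f : {rmorphism R -> S}) (x y : 'I_n -> S) p k :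
  (msize p <= k)%N ->
  mmap f (fun j => x j + y j) p =
    \sum_(phi : {ffun 'I_n -> 'I_k})
      mmap f x (hasse [multinom phi j : nat | j < n] p) * \prod_j y j ^+ phi j.
Proof.
move=> le; rewrite (mmapE k) //.
under [RHS]eq_bigr => phi _ do rewrite (mmap_hasse _ _ _ le) big_distrl /=.
rewrite exchange_big /=; apply: eq_bigr => e _.
have lte j : (e j < k)%N.
  by apply: leq_ltn_trans (bmdeg e); rewrite mdegE (bigD1 j) //= leq_addr.
have -> : mmap1 (fun j => x j + y j) e =
    \prod_j \sum_(t < k) (x j ^+ (e j - t) * y j ^+ t) *+ 'C(e j, t).
  rewrite /mmap1; apply: eq_bigr => j _; rewrite exprDn.
  (* Binomials with [t > e j] are zero; the common range [t < k] allows the product of sums to be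
     expanded over all functions [phi]. *)
  rewrite (big_ord_widen k (fun t => (x j ^+ (e j - t) * y j ^+ t) *+ 'C(e j, t)) (lte j)).
  rewrite big_mkcond; apply: eq_bigr => t _.
  by case: ltnP => // lt; rewrite bin_small // mulr0n.
rewrite bigA_distr_bigA big_distrr /=; apply: eq_bigr => phi _.
rewrite prodrMn big_split /= /mmap1 /mbin.
under [X in _ = _ *+ X * _ * _]eq_bigr => j _ do rewrite mnmE.
under [X in _ = _ * X * _]eq_bigr => j _ do rewrite mnmBE mnmE.
by rewrite -mulrnAl mulrnAl -mulrnAr !mulrA mulrnAr -!mulrnAl.
Qed.

Lemma hasse_is_linear i : linear (hasse i).
Proof.
move=> c p q; apply/mpolyP => e.
by rewrite mcoeffD mcoeffZ !mcoeff_hasse mcoeffD mcoeffZ mulrnDl mulrnAr.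
Qed.

HB.instance Definition _ i :=
  GRing.isLinear.Build R {mpoly R[n]} {mpoly R[n]} _ (hasse i) (hasse_is_linear i).

Lemma hasseX i e : hasse i 'X_[e] = (mbin i e)%:R *: 'X_[R, e - i].
Proof. by rewrite /hasse msuppX big_seq1 mcoeffX eqxx. Qed.

(** For nonzero [e], the monomial [e + mlead p] exceeds the leading one, so only the constant term
    survives. Hence a nonzero polynomial has finite order of vanishing everywhere. *)
Lemma hasse_mlead p : hasse (mlead p) p = (mleadc p)%:MP.
Proof.
apply/mpolyP => e; rewrite mcoeff_hasse mcoeffC eq_sym.
have [<-|ne] := eqVneq 0%MM e.
  rewrite add0m mulr1 /mbin big1 ?mulr1n // => j _; exact: binn.
rewrite mulr0 mcoeff_gt_mlead ?mul0rn //.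
rewrite -[X in (X < _)%O]add0m ltmc_add2l.
by rewrite lt_neqAle ne le0m.
Qed.

Lemma hasse_min_order p (a : 'I_n -> R) : p != 0 ->
  exists i, (hasse i p).@[a] != 0 /\
    forall j, (mdeg j < mdeg i)%N -> (hasse j p).@[a] = 0.
Proof.
move=> p0; have lt : (mdeg (mlead p) < msize p)%N by rewrite msize_mdeg_lt // mlead_supp.
pose i0 : 'X_{1..n < msize p} := BMultinom lt.
have P0 : (hasse i0 p).@[a] != 0 by rewrite hasse_mlead mevalC mleadc_eq0.
case: (arg_minnP (P := fun i : 'X_{1..n < msize p} => (hasse i p).@[a] != 0)
  (fun i : 'X_{1..n < msize p} => mdeg i) P0) => i Pi Hi.
exists i; split=> // j ltj; apply/eqP; apply/negPn/negP => Pj.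
have ltj' : (mdeg j < msize p)%N by apply: leq_trans ltj (ltnW (bmdeg i)).
by have := Hi (BMultinom ltj') Pj; rewrite leqNgt ltj.
Qed.

End HasseDerivative.

(** * The Schwartz-Zippel lemma with multiplicities *)

Section UnivariateMultiplicity.
Variable K : idomainType.
Implicit Types (h : {poly K}).

Lemma dvdp_XsubC_exp_nderivn h c m :
  (forall k, (k < m)%N -> h^`N(k).[c] = 0) -> ('X - c%:P) ^+ m %| h.
Proof.
move=> h0.
have -> : h = \sum_(i < size h) (h^`N(i).[c])%:P * ('X - c%:P) ^+ i.
  rewrite -[LHS]comp_polyXr /comp_poly.
  rewrite -[in LHS](subrK c%:P 'X) addrC (nderiv_taylor_wide (n := size h)).
  - by apply: eq_bigr => i _; rewrite nderivn_map horner_map.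
  - exact: mulrC.
  - by rewrite size_map_polyC.
apply: (big_ind (fun q : {poly K} => ('X - c%:P) ^+ m %| q)) => [||i _]; first exact: dvdp0.
  by move=> x y; apply: dvdp_add.
have [lt|le] := ltnP i m; first by rewrite h0 // polyC0 mul0r dvdp0.
by rewrite dvdp_mull // dvdp_exp2l.
Qed.

(** Powers of ['X - (phi t)%:P] at distinct points are coprime, so their product divides [h]. *)
Lemma sum_multiplicity_le (T : finType) (phi : T -> K) (nu : T -> nat) h :
  injective phi -> h != 0 ->
  (forall t k, (k < nu t)%N -> h^`N(k).[phi t] = 0) ->
  (\sum_t nu t <= (size h).-1)%N.
Proof.
move=> inj h0 H.
have XN0 t : ('X - (phi t)%:P) ^+ nu t != 0 by rewrite expf_neq0 // polyXsubC_eq0.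
have dvd : \prod_t ('X - (phi t)%:P) ^+ nu t %| h.
  have := index_enum_uniq T; elim: (index_enum T) => [|t s IH] /=.
    by rewrite big_nil dvd1p.
  case/andP=> ts us; rewrite big_cons Gauss_dvdp ?IH ?andbT //.
    by apply: dvdp_XsubC_exp_nderivn => k /H.
  apply: coprimep_expl; rewrite coprimep_sym coprimep_XsubC /root horner_prod.
  rewrite prodf_seq_neq0; apply/allP => u us'; apply/implyP => _.
  rewrite horner_exp !hornerE expf_neq0 // subr_eq0 (inj_eq inj).
  by apply: contraNneq ts => ->.
have := dvdp_leq h0 dvd; rewrite size_prod; last by move=> t _; apply: XN0.
under eq_bigr => t _ do rewrite size_exp_XsubC -addn1.
rewrite big_split /= sum1_card subSn ?leq_addl // addnK.
by case: (size h).
Qed.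

End UnivariateMultiplicity.

Section Slices.
Variables (n : nat) (R : comNzRingType).
Implicit Types (p : {mpoly R[n.+1]}) (e : 'X_{1..n.+1}) (i : 'X_{1..n}).

Definition mtail e : 'X_{1..n} := [multinom e (lift ord0 j) | j < n].
Definition mcons k i : 'X_{1..n.+1} :=
  [multinom if unlift ord0 l is Some j then i j else k | l < n.+1].

Lemma mcons0 k i : mcons k i ord0 = k.
Proof. by rewrite mnmE unlift_none. Qed.

Lemma mconsS k i j : mcons k i (lift ord0 j) = i j.
Proof. by rewrite mnmE liftK. Qed.

Lemma mdeg_mcons k i : mdeg (mcons k i) = (k + mdeg i)%N.
Proof.
rewrite !mdegE big_ord_recl mcons0; congr addn.
by apply: eq_bigr => j _; rewrite mconsS.
Qed.

Lemma mdeg_mtail e : (mdeg (mtail e) + e ord0)%N = mdeg e.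
Proof.
rewrite addnC !mdegE big_ord_recl; congr addn.
by apply: eq_bigr => j _; rewrite mnmE.
Qed.

Lemma mtail_inj e e' : e ord0 = e' ord0 -> mtail e = mtail e' -> e = e'.
Proof.
move=> E0 /mnmP E; apply/mnmP => l; case: (unliftP ord0 l) => [j|] -> //.
by have := E j; rewrite !mnmE.
Qed.

(** The coefficient of the [k]-th power of the first variable, as a polynomial in the others. *)
Definition slice k p : {mpoly R[n]} :=
  \sum_(e <- msupp p | e ord0 == k) p@_e *: 'X_[mtail e].

Lemma mcoeff_slice p e : e \in msupp p -> (slice (e ord0) p)@_(mtail e) = p@_e.
Proof.
move=> he; rewrite /slice big_mkcond raddf_sum /= (bigD1_seq _ he) ?msupp_uniq //= eqxx.
rewrite mcoeffZ mcoeffX eqxx mulr1 big1 ?addr0 // => e' ne.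
case: eqP => [E|]; last by rewrite mcoeff0.
rewrite mcoeffZ mcoeffX; case: eqP => [E'|]; last by rewrite mulr0.
by rewrite (mtail_inj E E') eqxx in ne.
Qed.

Lemma msize_slice k p : (msize (slice k p) <= msize p - k)%N.
Proof.
apply: leq_trans (msize_sum _ _ _) _; apply/bigmax_leqP_seq => e he /eqP E.
apply: leq_trans (msizeZ_le _ _) _; rewrite msizeX -E.
by have := msize_mdeg_lt he; rewrite -(mdeg_mtail e); lia.
Qed.

(* The [i]-th derivative in the last [n] variables, restricted to the line through
   [a] parallel to the first axis. *)
Definition fiber i (a : 'I_n -> R) p : {poly R} :=
  \sum_(e <- msupp p)
     ((p@_e *+ mbin i (mtail e)) * mmap1 a (mtail e - i)%MM) *: 'X^(e ord0).

Lemma coef_fiber i a p k : (fiber i a p)`_k = (hasse i (slice k p)).@[a].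
Proof.
rewrite /fiber coef_sumMXn /slice (raddf_sum (hasse i)) (raddf_sum (meval a)) /=.
apply: eq_bigr => e _; rewrite linearZ /= hasseX !mevalZ mevalX mulrA; congr (_ * _).
by rewrite mulr_natr.
Qed.

Lemma nderivn_fiber i a p k (c : R) (x : 'I_n.+1 -> R) :
  x ord0 = c -> (forall j, x (lift ord0 j) = a j) ->
  (fiber i a p)^`N(k).[c] = (hasse (mcons k i) p).@[x].
Proof.
move=> x0 xS; rewrite /hasse /fiber !raddf_sum horner_sum; apply: eq_bigr => e _ /=.
rewrite linearZ /= nderivnXn mevalZ mevalX big_ord_recl mnmBE mcons0 x0.
under eq_bigr => j _ do rewrite xS mnmBE mconsS.
have -> : mbin (mcons k i) e = (mbin i (mtail e) * 'C(e ord0, k))%N.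
  rewrite mulnC /mbin big_ord_recl mcons0; congr muln.
  by apply: eq_bigr => j _; rewrite mconsS mnmE.
rewrite hornerZ hornerMn hornerXn.
have -> : mmap1 a (mtail e - i)%MM = \prod_(j < n) a j ^+ (e (lift ord0 j) - i j).
  by apply: eq_bigr => j _; rewrite mnmBE mnmE.
by rewrite mulrnA !mulrnAr !mulrnAl -!mulrA [X in _ = _ * X *+ _ *+ _]mulrC.
Qed.

End Slices.

(* Induction on [n]: the slice of top degree in the first variable is handled by
   the induction hypothesis, and its order of vanishing at the tail of a point
   bounds the excess of the multiplicity, which is paid for by a univariate
   polynomial whose degree is that of the slice (Dvir-Kopparty-Saraf-Sudan). *)
Theorem schwartz_zippel_mult (K : idomainType) (T : finType) (phi : T -> K) (n : nat)
    (p : {mpoly K[n]}) (mu : n.-tuple T -> nat) :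
  injective phi -> p != 0 ->
  (forall v i, (mdeg i < mu v)%N -> (hasse i p).@[fun j => phi (tnth v j)] = 0) ->
  (#|T| * \sum_v mu v <= (msize p).-1 * #|T| ^ n)%N.
Proof.
move=> inj; elim: n p mu => [|n IH] p mu p0 Hmu.
  rewrite big1 ?muln0 // => v _; apply/eqP; rewrite -leqn0 leqNgt; apply/negP => lt.
  have := Hmu v 0%MM; rewrite mdeg0 => /(_ lt) /eqP; apply/negP.
  have := hasse_mlead p; rewrite (nvar0_mnmE (mlead p)) => ->.
  by rewrite mevalC -(nvar0_mnmE (mlead p)) mleadc_eq0.
(* The exponent of the first variable is maximal at [e]: [k] is the degree of [p] in that variable
   and [q] its leading coefficient. *)
have [e he emax] : exists2 e, e \in msupp p &
    forall e', e' \in msupp p -> (e' ord0 <= e ord0)%N.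
  have := mlead_supp p0; case: (msupp p) => // e s _.
  elim: s e => [|e' s IHs] e.
    by exists e; rewrite ?mem_head // => e'; rewrite inE => /eqP ->.
  have [e1 h1 h2] := IHs e; have [le|lt] := leqP (e' ord0) (e1 ord0).
    exists e1; first by move: h1; rewrite !inE => /orP[] ->; rewrite ?orbT.
    move=> f; rewrite !inE => /or3P[/eqP->|/eqP->//|fs]; apply: h2; rewrite inE ?eqxx //.
    by rewrite fs orbT.
  exists e'; first by rewrite !inE eqxx orbT.
  move=> f; rewrite !inE => /or3P[/eqP->|/eqP->//|fs]; apply: leq_trans (ltnW lt);
    apply: h2; rewrite inE ?eqxx // fs orbT //.
set k := e ord0 in emax; set q := slice k p.
have q0 : q != 0.
  apply/eqP => E; have := mcoeff_slice he; rewrite -/k -/q E mcoeff0 => E'.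
  by move: he; rewrite mcoeff_msupp -E' eqxx.
have /fin_all_exists[im Him] (v : n.-tuple T) := hasse_min_order (fun j => phi (tnth v j)) q0.
have {}IH := IH q (fun v => mdeg (im v)) q0 (fun v => (Him v).2).
(* On the line above [v], the derivative of [p] of index [im v] has degree exactly [k]. Its [j]-th
   derivative at [t] is a derivative of [p] of order [j + mdeg (im v)], hence zero when this is
   below [mu]. *)
have fibP (v : n.-tuple T) : (\sum_t (mu [tuple of t :: v] - mdeg (im v)) <= k)%N.
  pose a j := phi (tnth v j); pose h := fiber (im v) a p.
  have hk : h`_k != 0 by rewrite coef_fiber; exact: (Him v).1.
  have sh : (size h <= k.+1)%N.
    apply/leq_sizeP => j ltj; rewrite coef_fiber /slice big_seq_cond big1 ?raddf0 //.
    by move=> e' /andP[/emax le /eqP E]; move: ltj; rewrite -E ltnNge le.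
  have h0 : h != 0 by apply: contraNneq hk => ->; rewrite coef0.
  apply: leq_trans (sum_multiplicity_le inj h0 _) _; last by case: (size h) sh.
  move=> t j ltj; rewrite (@nderivn_fiber _ _ _ _ _ _ _ (fun l => phi (tnth [tuple of t :: v] l))) //.
  - by apply: Hmu; rewrite mdeg_mcons; lia.
  - by move=> l; rewrite tnthS.
have -> : (\sum_v mu v = \sum_(v : n.-tuple T) \sum_t mu [tuple of t :: v])%N.
  rewrite pair_big /=.
  rewrite (reindex (fun u : n.-tuple T * T => [tuple of u.2 :: u.1])) //=.
  exists (fun v : n.+1.-tuple T => ([tuple of behead v], thead v)) => [[v t] _|v _] /=.
    by congr pair; apply: val_inj.
  by rewrite -tuple_eta.
have step (v : n.-tuple T) :
    (\sum_t mu [tuple of t :: v] <= #|T| * mdeg (im v) + k)%N.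
  apply: leq_trans (_ : \sum_t ((mu [tuple of t :: v] - mdeg (im v)) + mdeg (im v)) <= _)%N.
    by apply: leq_sum => t _; lia.
  by rewrite big_split /= sum_nat_const addnC leq_add2l.
apply: (@leq_trans (#|T| * (\sum_(v : n.-tuple T) (#|T| * mdeg (im v) + k)))%N).
  by rewrite leq_mul2l leq_sum ?orbT // => v _; apply: step.
rewrite big_split /= -big_distrr /= sum_nat_const card_tuple expnS mulnDr.
have lek : (k <= (msize p).-1)%N.
  have h := msize_mdeg_lt he; rewrite -ltnS (ltn_predK h) (leq_ltn_trans _ h) //.
  by rewrite -(mdeg_mtail e) leq_addl.
have : ((msize q).-1 <= (msize p).-1 - k)%N.
  by have := msize_slice k p; rewrite -/q; move: (msize q) (msize p) => x y; lia.
move=> lq; apply: (@leq_trans (#|T| * (((msize p).-1 - k) * #|T| ^ n) + #|T| * (#|T| ^ n * k))%N).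
  rewrite leq_add2r leq_mul2l; apply/orP; right; apply: leq_trans IH _.
  by rewrite leq_mul2r lq orbT.
by rewrite -mulnDr (mulnC (#|T| ^ n)%N) -mulnDl subnK // mulnCA.
Qed.

(** * Restriction to affine subspaces and to the top form *)

Lemma card_bmultinom n k : #|{: 'X_{1..n < k.+1}}| = 'C(n + k, n).
Proof.
pose f (e : 'X_{1..n < k.+1}) : n.-tuple 'I_k.+1 := [tuple inord (e j) | j < n].
have lte (e : 'X_{1..n < k.+1}) j : (e j < k.+1)%N.
  by apply: leq_ltn_trans (bmdeg e); rewrite mdegE (bigD1 j) //= leq_addr.
have fE e j : tnth (f e) j = e j :> nat by rewrite tnth_mktuple inordK.
have sumf (t : n.-tuple 'I_k.+1) : (\sum_(i <- t) i = \sum_j tnth t j)%N.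
  by rewrite big_tuple.
rewrite -card_partial_ord_partitions -cardsT -(card_imset _ (f := f)).
  apply: eq_card => t; rewrite inE sumf.
  apply/imsetP/idP => [[e _ ->]|h].
    under eq_bigr => j _ do rewrite fE.
    by rewrite -mdegE -ltnS bmdeg.
  have d : (mdeg [multinom (tnth t j : nat) | j < n] < k.+1)%N.
    by rewrite mdegE ltnS; under eq_bigr => j _ do rewrite mnmE.
  exists (BMultinom d) => //; apply: eq_from_tnth => j; apply: val_inj.
  by rewrite /= fE /= mnmE.
move=> e e' E; apply: val_inj; apply/mnmP => j.
by rewrite -!fE E.
Qed.

(** The conditions form a homogeneous linear system on the coefficients, with fewer equations than
    unknowns. *)
Lemma exists_mpoly_vanishing (F : fieldType) (N m d : nat) (T : finType) (b : T -> 'I_N -> F) :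
  (#|T| * #|{: 'X_{1..N < m}}| < #|{: 'X_{1..N < d.+1}}|)%N ->
  exists p : {mpoly F[N]}, [/\ p != 0, (msize p <= d.+1)%N &
    forall t i, (mdeg i < m)%N -> (hasse i p).@[b t] = 0].
Proof.
rewrite -card_prod => lt.
pose U : finType := 'X_{1..N < d.+1}; pose E : finType := (T * 'X_{1..N < m})%type.
pose A : 'M[F]_(#|U|, #|E|) :=
  \matrix_(u, c) (hasse (@enum_val E E c).2 'X_[bmnm (@enum_val U U u)]).@[b (@enum_val E E c).1].
have : kermx A != 0.
  rewrite kermx_eq0 /row_free neq_ltn; apply/orP; left.
  exact: leq_ltn_trans (rank_leq_col A) lt.
case/rowV0Pn => v /sub_kermxP vA v0.
pose p : {mpoly F[N]} := \sum_(e : 'X_{1..N < d.+1}) v 0 (enum_rank e) *: 'X_[e].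
exists p; split.
- apply: contraNneq v0 => p0; apply/eqP/rowP => u; rewrite mxE.
  have := bmdeg (@enum_val U U u) => /(mcoeff_mpoly
    (fun e => if insub e is Some e' then v 0 (enum_rank (e' : 'X_{1..N < d.+1})) else 0)).
  under eq_bigr => e _ do rewrite valK.
  by rewrite -/p p0 mcoeff0 valK enum_valK.
- apply: leq_trans (msize_sum _ _ _) _; apply/bigmax_leqP => e _.
  by apply: leq_trans (msizeZ_le _ _) _; rewrite msizeX bmdeg.
move=> t i lti.
have := congr1 (fun w : 'rV_#|E| => w 0 (enum_rank (t, BMultinom lti))) vA.
rewrite !mxE => <-; rewrite /p !(raddf_sum (hasse i)) (raddf_sum (meval (b t))) /=.
rewrite (reindex (@enum_val U U)) /=; last exact: onW_bij (enum_val_bij _).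
apply: eq_bigr => u _.
by rewrite linearZ /= mevalZ enum_valK mxE enum_rankK.
Qed.

Section AffineRestriction.
Variable R : comNzRingType.

Lemma rmorph_mmap n (S S' : comNzRingType) (g : {rmorphism S -> S'}) (f : R -> S)
    (h : 'I_n -> S) (p : {mpoly R[n]}) :
  g (mmap f h p) = mmap (g \o f) (g \o h) p.
Proof.
rewrite /mmap rmorph_sum; apply: eq_bigr => e _.
rewrite rmorphM rmorph_prod; congr (_ * _); apply: eq_bigr => j _.
by rewrite rmorphXn.
Qed.

Lemma eq_mmap n (S : nzRingType) (f f' : R -> S) (h h' : 'I_n -> S) (p : {mpoly R[n]}) :
  f =1 f' -> h =1 h' -> mmap f h p = mmap f' h' p.
Proof.
move=> ef eh; rewrite /mmap; apply: eq_bigr => e _; rewrite ef; congr (_ * _).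
exact: mmap1_eq.
Qed.

Lemma mmap_const n (S : comNzRingType) (f : {rmorphism R -> S}) (c : 'I_n -> R)
    (p : {mpoly R[n]}) : mmap f (fun l => f (c l)) p = f (p.@[c]).
Proof. by rewrite /meval rmorph_mmap. Qed.

Lemma mcoeff_translate n (p : {mpoly R[n]}) (c : 'I_n -> R) kappa :
  (mmap (@mpolyC n R) (fun l => (c l)%:MP + 'X_l) p)@_kappa = (hasse kappa p).@[c].
Proof.
(* The box is enlarged so that [kappa] itself is an index of Taylor's sum, taken with increments
   ['X_l]. *)
pose k := (msize p + mdeg kappa).+1.
have le : (msize p <= k)%N by rewrite /k; lia.
have ltk l : (kappa l < k)%N.
  apply: (@leq_ltn_trans (mdeg kappa)); last by rewrite /k; lia.
  by rewrite mdegE (bigD1 l) //= leq_addr.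
rewrite (mmap_taylor _ _ _ le) raddf_sum /=.
rewrite (bigD1 [ffun l => Ordinal (ltk l)]) //=.
have E q := mmap_const (@mpolyC n R) c q; rewrite /= in E; rewrite E.
have -> : [multinom ([ffun l => Ordinal (ltk l)] j : 'I_k) : nat | j < n] = kappa.
  by apply/mnmP => l; rewrite mnmE ffunE.
rewrite mul_mpolyC mcoeffZ [X in _ + X]big1 ?addr0 => [|phi ne]; last first.
  rewrite E mul_mpolyC mcoeffZ.
  have -> : \prod_j ('X_j : {mpoly R[n]}) ^+ phi j = 'X_[ [multinom phi j : nat | j < n] ].
    by rewrite mpolyXE_id; apply: eq_bigr => j _; rewrite mnmE.
  rewrite mcoeffX; case: eqP => [e|]; last by rewrite mulr0.
  case/eqP: ne; apply/ffunP => l; apply: val_inj.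
  by rewrite ffunE /= -e mnmE.
have -> : \prod_j ('X_j : {mpoly R[n]}) ^+ [ffun l => Ordinal (ltk l)] j = 'X_[kappa].
  by rewrite mpolyXE_id; apply: eq_bigr => j _; rewrite ffunE.
by rewrite mcoeffX eqxx mulr1.
Qed.

Variables (k N : nat) (a : 'I_N -> R) (u : 'I_k -> 'I_N -> R).

Definition affine_form (j : 'I_N) : {mpoly R[k]} := (a j)%:MP + \sum_l u l j *: 'X_l.

Definition affine_restr (p : {mpoly R[N]}) : {mpoly R[k]} :=
  mmap (@mpolyC k R) affine_form p.

Lemma prod_homog (L : 'I_N -> {mpoly R[k]}) (phi : 'I_N -> nat) :
  (forall j, L j \is 1.-homog) ->
  \prod_j L j ^+ phi j \is (\sum_j phi j)%N.-homog.
Proof.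
move=> hL; apply: (big_ind2 (fun (q : {mpoly R[k]}) (s : nat) => q \is s.-homog)).
- exact: dhomog1.
- by move=> q1 s1 q2 s2; apply: dhomogM.
by move=> j _; have := dhomogMn (phi j) (hL j); rewrite mul1n.
Qed.

(** Translated by [c], the restriction is [p] at [b + L] with linear forms [L]. In Taylor's formula,
    terms of order below [M] have zero coefficient, and the others are homogeneous of degree at
    least [M], so they do not contain [kappa]. *)
Lemma hasse_affine_restr_eq0 (p : {mpoly R[N]}) (c : 'I_k -> R) M kappa :
  (forall j, (mdeg j < M)%N ->
     (hasse j p).@[fun l => a l + \sum_s c s * u s l] = 0) ->
  (mdeg kappa < M)%N -> (hasse kappa (affine_restr p)).@[c] = 0.
Proof.
move=> vanish ltM; rewrite -mcoeff_translate /affine_restr rmorph_mmap.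
pose b l := a l + \sum_s c s * u s l.
pose L (j : 'I_N) : {mpoly R[k]} := \sum_s u s j *: 'X_s.
rewrite (@eq_mmap _ _ _ (@mpolyC k R) _ (fun j => (b j)%:MP + L j)); first last.
- move=> j; rewrite /= /affine_form rmorphD /= mmapC raddf_sum /b mpolyCD -addrA.
  congr (_ + _); rewrite raddf_sum /L -big_split /=; apply: eq_bigr => s _.
  by rewrite mmapZ mmapX mmap1U mulrDr -mpolyCM mul_mpolyC mulrC.
- by move=> x; rewrite /= mmapC.
rewrite (mmap_taylor _ _ _ (leqnn _)) raddf_sum big1 //= => phi _.
have E q := mmap_const (@mpolyC k R) b q; rewrite /= in E; rewrite E mul_mpolyC mcoeffZ.
have [lt|le] := ltnP (mdeg [multinom phi j : nat | j < N]) M.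
  by rewrite vanish // mul0r.
have hom : \prod_j L j ^+ phi j \is (\sum_j phi j)%N.-homog.
  apply: (@prod_homog L (fun j => phi j : nat)) => j; apply: rpred_sum => s _.
  by apply: rpredZ; rewrite dhomogX; apply/eqP/mdeg1.
rewrite (dhomog_nemf_coeff hom) ?mulr0 // neq_ltn; apply/orP; left.
apply: leq_trans ltM (leq_trans le _); rewrite mdegE.
by under eq_bigr => j _ do rewrite mnmE.
Qed.

Lemma msize_affine_restr (p : {mpoly R[N]}) : (msize (affine_restr p) <= msize p)%N.
Proof.
pose D s (q : {mpoly R[k]}) := forall e, e \in msupp q -> (mdeg e <= s)%N.
have DM s s' q q' : D s q -> D s' q' -> D (s + s')%N (q * q').
  move=> h h' e /msuppM_le /allpairsP [[e1 e2] /= [/h h1 /h' h2 ->]].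
  by rewrite mdegD leq_add.
have D1 : D 0%N 1 by move=> e; rewrite msupp1 inE => /eqP ->; rewrite mdeg0.
have DL j : D 1%N (affine_form j).
  move=> e /msuppD_le; rewrite mem_cat => /orP[].
    by rewrite msuppC; case: ifP => // _; rewrite inE => /eqP ->; rewrite mdeg0.
  move/msupp_sum_le => /flattenP [s /mapP [l _ ->]] /msuppZ_le.
  by rewrite msuppX inE => /eqP ->; rewrite mdeg1.
have DX j s : D s (affine_form j ^+ s).
  by elim: s => [|s IH]; rewrite ?expr0 // exprS -add1n; apply: DM.
apply: leq_trans (msize_sum _ _ _) _; apply/bigmax_leqP_seq => e he _.
rewrite mul_mpolyC; apply: leq_trans (msizeZ_le _ _) _.
apply: leq_trans (msize_mdeg_lt he); rewrite msizeE; apply/bigmax_leqP_seq => e'.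
rewrite ltnS [mdeg e]mdegE => h _.
have De : D (\sum_j e j)%N (mmap1 affine_form e).
  apply: (big_ind2 (fun (q : {mpoly R[k]}) (s : nat) => D s q)) => //.
  by move=> *; apply: DM.
exact: De h.
Qed.

End AffineRestriction.

Lemma schwartz_zippel_set (K : idomainType) (T : finType) (phi : T -> K) (n M : nat)
    (p : {mpoly K[n]}) (V : {set n.-tuple T}) :
  injective phi -> p != 0 ->
  (forall v i, v \in V -> (mdeg i < M)%N -> (hasse i p).@[fun j => phi (tnth v j)] = 0) ->
  (#|T| * (M * #|V|) <= (msize p).-1 * #|T| ^ n)%N.
Proof.
move=> inj p0 H.
have -> : (M * #|V| = \sum_v (if v \in V then M else 0))%N.
  by rewrite -big_mkcond sum_nat_const mulnC.
apply: (schwartz_zippel_mult inj) => // v i.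
by case: ifP => // vV; apply: H.
Qed.

Lemma coefM_top (R : nzSemiRingType) (p q : {poly R}) a b :
  (size p <= a.+1)%N -> (size q <= b.+1)%N -> (p * q)`_(a + b) = p`_a * q`_b.
Proof.
move=> sp sq; rewrite coefM.
have lt : (a < (a + b).+1)%N by rewrite ltnS leq_addr.
rewrite (bigD1 (Ordinal lt)) //= addKn big1 ?addr0 // => i ne.
have [lti|lei] := ltnP a i.
  by rewrite (nth_default _ (leq_trans sp lti)) mul0r.
have ltia : (i < a)%N by rewrite ltn_neqAle lei andbT.
rewrite [X in _ * X]nth_default ?mulr0 //; apply: leq_trans sq _.
by have := ltn_ord i; lia.
Qed.

Lemma mmap1_line (A : comNzRingType) N (a z : 'I_N -> A) (e : 'X_{1..N}) :
  let q := mmap1 (fun j => (a j)%:P + z j *: 'X) e in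
  (size q <= (mdeg e).+1)%N /\ q`_(mdeg e) = mmap1 z e.
Proof.
pose top (s : nat) (c : A) (q : {poly A}) := (size q <= s.+1)%N /\ q`_s = c.
have topM s c q s' c' q' : top s c q -> top s' c' q' -> top (s + s')%N (c * c') (q * q').
  move=> [sq cq] [sq' cq']; split; last by rewrite coefM_top // cq cq'.
  by apply: leq_trans (size_polyMleq _ _) _; lia.
have top1 : top 0%N 1 1 by split; rewrite ?size_poly1 ?coef1.
have topL j : top 1%N (z j) ((a j)%:P + z j *: 'X).
  split; last by rewrite coefD coefC coefZ coefX /= add0r mulr1.
  apply: leq_trans (size_polyD _ _) _; rewrite geq_max.
  rewrite (leq_trans (size_polyC_leq1 _)) //=.
  by apply: leq_trans (size_scale_leq _ _) _; rewrite size_polyX.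
have topX j s : top s (z j ^+ s) (((a j)%:P + z j *: 'X) ^+ s).
  elim: s => [|s IH]; first by rewrite !expr0.
  by rewrite !exprS -add1n; apply: topM.
rewrite /= mdegE; apply: (big_ind3 top) => // *; exact: topM.
Qed.

Section TopForm.
Variables (F A : comNzRingType) (iota : {rmorphism F -> A}) (N d : nat).
Variable (p : {mpoly F[N]}).

(** The homogeneous part of degree [d], with coefficients moved to [A], so that it can be evaluated
    at points outside [F]. *)
Definition top_form : {mpoly A[N]} :=
  \sum_(e : 'X_{1..N < d.+1}) (if mdeg e == d then iota p@_e else 0) *: 'X_[e].

Lemma mcoeff_top_form e : (mdeg e <= d)%N ->
  top_form@_e = if mdeg e == d then iota p@_e else 0.
Proof.
rewrite -ltnS => lt; rewrite /top_form.
exact: (mcoeff_mpoly (fun e => if mdeg e == d then iota p@_e else 0) lt).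
Qed.

Lemma msize_top_form : (msize top_form <= d.+1)%N.
Proof.
apply: leq_trans (msize_sum _ _ _) _; apply/bigmax_leqP => e _.
by apply: leq_trans (msizeZ_le _ _) _; rewrite msizeX bmdeg.
Qed.

(* On the lines [a + 'X z] with [z] in the span of the directions [u], the
   coefficient of ['X^(d - |i|)] in the restriction of [hasse i p] is the value
   at [z] of [hasse i] of the top-degree form. *)
Lemma hasse_top_form_eq0 k (a : 'I_N -> F) (u : 'I_k -> 'I_N -> F) (beta : 'I_k -> A) i :
  (msize p <= d.+1)%N -> affine_restr a u (hasse i p) = 0 ->
  (hasse i top_form).@[fun j => \sum_l iota (u l j) * beta l] = 0.
Proof.
move=> le r0; pose z j := \sum_l iota (u l j) * beta l.
have f0 : mmap (polyC \o iota) (fun j => (iota (a j))%:P + z j *: 'X) (hasse i p) = 0.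
  (* The line lies in the flat: it is the image of the parameters [beta l *: 'X]. *)
  transitivity (mmap (polyC \o iota) (fun l => beta l *: 'X) (affine_restr a u (hasse i p))).
    rewrite /affine_restr rmorph_mmap; apply: eq_mmap => [x|j].
      by rewrite /= mmapC.
    rewrite /= /affine_form rmorphD /= mmapC raddf_sum /z scaler_suml; congr (_ + _).
    apply: eq_bigr => l _. rewrite /= mmapZ mmapX mmap1U /=.
    by rewrite mul_polyC scalerA.
  by rewrite r0 raddf0.
have : (mmap (polyC \o iota) (fun j => (iota (a j))%:P + z j *: 'X) (hasse i p))`_(d - mdeg i) = 0.
  by rewrite f0 coef0.
rewrite (mmap_hasse _ _ _ le) coef_sum => {f0} E; rewrite -[RHS]E.
rewrite /top_form (raddf_sum (hasse i)) (raddf_sum (meval _)) /=; apply: eq_bigr => e _.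
rewrite linearZ /= hasseX !mevalZ mevalX -polyCMn coefCM -/(mmap1 z _) mulrA.
have [ie|nie] := boolP (i <= e)%MM; last by rewrite mbinNle // mulr0n !mulr0 !mul0r.
have [sz top] := mmap1_line (fun j => iota (a j)) z (e - i)%MM.
have dE : (mdeg (e - i)%MM + mdeg i)%N = mdeg e by rewrite -mdegD submK.
have led : (mdeg e <= d)%N by rewrite -ltnS bmdeg.
case: eqP => [Ed|ne].
  have -> : (d - mdeg i)%N = mdeg (e - i)%MM by lia.
  by rewrite top mulr_natr.
rewrite !mul0r nth_default ?mulr0 //; apply: leq_trans sz _; lia.
Qed.

End TopForm.

(** * Sets that almost contain planes in many directions *)

(** Bernoulli's inequality [(1 - 1/(k+1))^N >= 1 - N/(k+1)] without denominators. *)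
Lemma expnS_bernoulli k N : (k.+1 ^ N * (k.+1 - N) <= k.+1 * k ^ N)%N.
Proof.
elim: N => [|N IH]; first by rewrite !expn0 subn0 muln1 mul1n.
rewrite subSS (expnS k) mulnCA.
have h : (k.+1 * (k - N) <= k * (k.+1 - N))%N.
  by have [le|lt] := leqP N k; [nia | rewrite (eqP (ltnW lt)) muln0].
rewrite expnSr -mulnA; apply: leq_trans (leq_mul (leqnn _) h) _.
by rewrite mulnCA leq_mul2l IH orbT.
Qed.

Lemma expn_2n1_le n N : (N <= n)%N -> ((n.*2.+1) ^ N <= 2 * n.*2 ^ N)%N.
Proof.
move=> le; have := expnS_bernoulli n.*2 N.
move: (n.*2.+1 ^ N)%N (n.*2 ^ N)%N => x y h.
have le2 : (n.*2.+1 * x <= n.*2.+1 * (2 * y))%N.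
  apply: (@leq_trans (2 * (x * (n.*2.+1 - N)))%N); last by lia.
  by rewrite [leqRHS]mulnCA [leqLHS]mulnC leq_mul2l; apply/orP; right; lia.
by rewrite leq_pmul2l in le2.
Qed.

(* The ratio of the number of monomials of degree at most [3nqw] to the number
   of vanishing conditions of order [(3n+1)w+3n-1] at a point is at least [q^N/2]. *)
Lemma bin_ratio q n N w : (N <= n)%N -> (0 < n)%N -> (8 * n <= w)%N ->
  (q ^ N * 'C(N + ((3 * n).+1 * w + 3 * n - 2), N) <= 2 * 'C(N + 3 * n * q * w, N))%N.
Proof.
move=> leN n0 lew.
set x := (N + (_ - 2))%N; set y := (N + _)%N.
have f0 := fact_gt0 N.
rewrite -(leq_pmul2r f0) -!mulnA !bin_ffact !ffact_prod.
have p0 : (0 < n.*2 ^ N)%N by rewrite expn_gt0; apply/orP; left; lia.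
rewrite -(leq_pmul2l p0) mulnA -expnMn.
(* Factor by factor, [(y - i) / (x - i)] is at least [q] times [2n / (2n+1)]; the total loss
   [(1 + 1/(2n))^N] is at most 2. *)
apply: (@leq_trans (n.*2.+1 ^ N * \prod_(i < N) (y - i))%N); last first.
  by rewrite mulnA (mulnC _ 2) leq_mul2r expn_2n1_le ?orbT.
have E c : (c ^ N = \prod_(i < N) c)%N by rewrite prod_nat_const card_ord.
rewrite !E -!big_split /=; apply: leq_prod => i _.
apply: (@leq_trans (n.*2 * q * x)%N); first by rewrite leq_mul2l leq_subr orbT.
apply: (@leq_trans (n.*2.+1 * (3 * n * q * w))%N); last first.
  by rewrite leq_mul2l; apply/orP; right; rewrite /y; have := ltn_ord i; lia.
have -> : (n.*2 * q * x = q * (n.*2 * x))%N by lia.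
have -> : (n.*2.+1 * (3 * n * q * w) = q * (n.*2.+1 * (3 * n * w)))%N by lia.
rewrite leq_mul2l; apply/orP; right.
(* Here [w >= 8n] absorbs the terms of [x] without a factor [w]. *)
rewrite /x; nia.
Qed.

(* Method of multiplicities for planes: a nonzero polynomial vanishing to high
   order on [B] has all its low-order derivatives identically zero on the planes
   that [B] almost contains, so that its top form vanishes to order [3n] at the
   directions [p 0 + p 1 'X] of these planes. *)
Theorem kakeya_planes (F : finFieldType) (N n : nat)
    (B : {set 'rV[F]_N}) (G : {set 'M[F]_(2, N)}) :
  (1 < n)%N -> (N <= n)%N -> (32 * n <= #|F|)%N ->
  (#|F| ^ (2 * N) < 3 * #|G|)%N ->
  (forall p, p \in G -> exists a : 'rV[F]_N,
     ((4 * n - 1) * #|F| ^ 2 <= 4 * n * #|[set c : 'rV[F]_2 | (a + c *m p)%R \in B]|)%N) ->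
  (#|F| ^ N <= 2 * #|B|)%N.
Proof.
move=> n1 leN leq ltG HG; have n0 := ltnW n1; set q := #|F| in leq ltG HG *.
(* [8n <= w] is what [bin_ratio] requires, and [3w <= q] makes the final count contradict
   [q^(2N) < 3 #|G|]. *)
pose w := (q %/ 3)%N.
have w8 : (8 * n <= w)%N by rewrite /w; lia.
have w3 : (3 * w <= q)%N by rewrite /w; lia.
rewrite leqNgt; apply/negP => ltB.
(* Vanishing to order [m + 1] leaves order [(3n+1)w] after any derivative of order below [3n]. *)
pose m := ((3 * n).+1 * w + 3 * n - 2)%N; pose d := (3 * n * q * w)%N.
have lt : (#|{: {x | x \in B}}| * #|{: 'X_{1..N < m.+1}}| < #|{: 'X_{1..N < d.+1}}|)%N.
  have -> : #|{: {x | x \in B}}| = #|B| by rewrite card_sig; apply: eq_card.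
  rewrite !card_bmultinom.
  have c0 : (0 < 'C(N + m, N))%N by rewrite bin_gt0 leq_addr.
  have := bin_ratio q leN n0 w8; rewrite -/m -/d => h.
  have : (2 * #|B| * 'C(N + m, N) < q ^ N * 'C(N + m, N))%N by rewrite ltn_mul2r c0.
  lia.
have [P [P0 sP vP]] := exists_mpoly_vanishing (fun (x : {x | x \in B}) j => val x 0 j) lt.
have {}vP (x : 'rV_N) i : x \in B -> (mdeg i < m.+1)%N -> (hasse i P).@[fun j => x 0 j] = 0.
  by move=> xB; apply: (vP (exist _ x xB)).
(* The exact degree, possibly below [d], ensures that the top form is nonzero. *)
pose dP := (msize P).-1.
have sPd : msize P = dP.+1 by rewrite /dP -mlead_deg.
have restr0 p i : p \in G -> (mdeg i < 3 * n)%N ->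
    exists a, affine_restr a (fun l j => p l j) (hasse i P) = 0.
  move=> /HG [a ha] lti; exists (fun j => a 0 j).
  set g := affine_restr _ _ _; apply/eqP; apply/negPn/negP => g0.
  pose V := [set [tuple (c : 'rV[F]_2) 0 j | j < 2] | c in [set c : 'rV[F]_2 | (a + c *m p)%R \in B]].
  have cV : #|V| = #|[set c : 'rV[F]_2 | (a + c *m p)%R \in B]|.
    apply: card_imset => c c' /(congr1 (fun t => tnth t)) E.
    by apply/rowP => j; have := congr1 (fun f => f j) E; rewrite !tnth_mktuple.
  rewrite -cV in ha.
  have H : (q * ((3 * n).+1 * w * #|V|) <= (msize g).-1 * q ^ 2)%N.
    apply: (@schwartz_zippel_set F F id 2 _ g V) => //.
    move=> v kappa /imsetP [c]; rewrite inE => hc -> ltk.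
    apply: (hasse_affine_restr_eq0 (M := ((3 * n).+1 * w)%N)) => // j ltj.
    rewrite hasse_hasse mevalMn -[RHS](mul0rn _ (mbin i (j + i)%MM)); congr (_ *+ _).
    rewrite -[RHS](vP _ (j + i)%MM hc); last by rewrite mdegD /m; lia.
    apply: meval_eq => l; rewrite !mxE; congr (_ + _). apply: eq_bigr => s _.
    by rewrite tnth_mktuple.
  have le1 : ((msize g).-1 <= d)%N.
    rewrite -subn1 leq_subLR add1n.
    exact: leq_trans (msize_affine_restr _ _ _) (leq_trans (msize_hasse i P) sP).
  have := leq_trans H (leq_mul le1 (leqnn _)); rewrite /d.
  have q0 : (0 < q)%N by lia.
  have -> : (q * ((3 * n).+1 * w * #|V|) = q * w * ((3 * n).+1 * #|V|))%N by lia.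
  have -> : (3 * n * q * w * q ^ 2 = q * w * (3 * n * q ^ 2))%N by lia.
  rewrite leq_pmul2l ?muln_gt0 ?q0 //=; last by lia.
  (* The bound [(3n+1) #|V| <= 3n q^2] contradicts [#|V| >= (1 - 1/(4n)) q^2], because
     [(3n+1)(4n-1) > 12n^2] for [n > 1]. *)
  move: ha n1; have : (0 < q ^ 2)%N by rewrite expn_gt0 q0.
  move: (q ^ 2)%N (#|V|) => x z; clear; nia.
pose Q := top_form (polyC : {rmorphism F -> {poly F}}) dP P.
have Q0 : Q != 0.
  have dl : mdeg (mlead P) = dP by rewrite /dP -mlead_deg.
  apply/eqP => E; have := mcoeff_top_form (polyC : {rmorphism F -> {poly F}}) P (eq_leq dl).
  rewrite -/Q E mcoeff0 dl eqxx => /esym /eqP; rewrite polyC_eq0.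
  by rewrite mleadc_eq0 (negbTE P0).
(* Polynomials of degree at most 1 form a grid of side [q^2], in which each matrix [p] is a single
   point. *)
pose phi (xy : F * F) : {poly F} := xy.1%:P + xy.2 *: 'X.
have phi_inj : injective phi.
  move=> [x y] [x' y'] E; congr pair.
    by have := congr1 (coefp 0) E; rewrite /= !coefE /= !mulr0 !addr0.
  by have := congr1 (coefp 1) E; rewrite /= !coefE /= !mulr1 !add0r.
pose V := [set [tuple ((p : 'M[F]_(2, N)) 0 j, p 1 j) | j < N] | p in G].
have cV : #|V| = #|G|.
  apply: card_imset => p p' /(congr1 (fun t => tnth t)) E.
  apply/matrixP => l j; have := congr1 (fun f => f j) E; rewrite !tnth_mktuple => -[e0 e1].
  by case: l => [[|[|//]] lp]; [have -> : Ordinal lp = 0 by apply: val_inj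
    | have -> : Ordinal lp = 1 by apply: val_inj].
have H : (#|{: F * F}| * ((3 * n) * #|V|) <= (msize Q).-1 * #|{: F * F}| ^ N)%N.
  apply: (schwartz_zippel_set phi_inj Q0) => v i /imsetP [p pG ->] lti.
  have [a r0] := restr0 p i pG lti.
  have := @hasse_top_form_eq0 F {poly F} polyC N dP P 2 a (fun l j => p l j)
    (fun l => if l == 0 then 1 else 'X) i _ r0.
  rewrite sPd leqnn => /(_ isT) E; rewrite -[RHS]E; apply: meval_eq => j.
  rewrite tnth_mktuple /phi big_ord_recl big_ord1 /= mulr1 mul_polyC.
  by congr (_ + p _ j *: _); apply: val_inj.
have le1 : ((msize Q).-1 <= d)%N.
  have := msize_top_form (polyC : {rmorphism F -> {poly F}}) dP P; rewrite -/Q.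
  by rewrite -subn1 leq_subLR add1n => /leq_trans; apply; rewrite -sPd.
have := leq_trans H (leq_mul le1 (leqnn _)); rewrite card_prod -/q cV /d.
have -> : ((q * q) ^ N = q ^ (2 * N))%N by rewrite mulnn -expnM.
move: ltG; move: (q ^ _)%N (#|G|) => x y ltG h.
have c0 : (0 < 3 * n * q * q)%N by rewrite !muln_gt0 /=; lia.
suff : (3 * n * q * q * (3 * y) <= 3 * n * q * q * x)%N by rewrite leq_pmul2l //; lia.
apply: (@leq_trans (3 * n * q * x * (3 * w))%N); first by lia.
by rewrite [leqRHS](_ : _ = 3 * n * q * x * q)%N ?leq_mul2l ?w3 ?orbT //; lia.
Qed.

(** * Fibers of random linear maps *)

Section MatrixCounting.
Variable F : finFieldType.
Notation q := #|F|.

(** The map [C |-> v *m C] is additive and onto, so its fibers are translates of one another. *)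
Lemma card_mulmx_fiber n k (v : 'rV[F]_n) (c : 'rV[F]_k) : v != 0 ->
  (#|[set C : 'M[F]_(n, k) | v *m C == c]| * q ^ k = q ^ (n * k))%N.
Proof.
move=> /rV0Pn [j vj].
have ex (d : 'rV[F]_k) : v *m ((v 0 j)^-1 *: (delta_mx j 0 *m d)) = d.
  rewrite -scalemxAr mulmxA (_ : v *m delta_mx j 0 = (v 0 j)%:M); last first.
    by rewrite -colE; apply/matrixP => i i'; rewrite !ord1 !mxE eqxx.
  by rewrite mul_scalar_mx scalerA mulVf // scale1r.
have fib d : #|[set C : 'M[F]_(n, k) | v *m C == d]| = #|[set C : 'M[F]_(n, k) | v *m C == c]|.
  rewrite -(card_imset _ (addrI ((v 0 j)^-1 *: (delta_mx j 0 *m (c - d))))).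
  apply: eq_card => C; rewrite inE; apply/imsetP/eqP => [[C' + ->]|E].
    by rewrite inE mulmxDr ex => /eqP ->; rewrite subrK.
  exists (C - (v 0 j)^-1 *: (delta_mx j 0 *m (c - d))); last by rewrite addrC subrK.
  by rewrite inE mulmxBr ex E opprB addrC subrK.
have : (\sum_(d : 'rV[F]_k) #|[set C : 'M[F]_(n, k) | v *m C == d]| = q ^ (n * k))%N.
  rewrite -(card_mx F n k) -sum1_card (partition_big (fun C => v *m C) xpredT) //=.
  by apply: eq_bigr => d _; rewrite -sum1dep_card.
by rewrite (eq_bigr _ (fun d _ => fib d)) sum_nat_const card_mx mul1n mulnC.
Qed.

(** Union bound over the nonzero vectors [v] of the left kernel. *)
Lemma card_not_row_free a b :
  (#|[set M : 'M[F]_(a, b) | ~~ row_free M]| * q ^ b <= q ^ a * q ^ (a * b))%N.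
Proof.
apply: (@leq_trans ((\sum_(v : 'rV[F]_a | (v != 0)%R)
    #|[set M : 'M[F]_(a, b) | (v *m M == 0)%R]|) * q ^ b)%N).
  rewrite leq_mul2r; apply/orP; right.
  under eq_bigr => v _ do rewrite -sum1dep_card big_mkcond.
  rewrite exchange_big /= -sum1dep_card big_mkcond; apply: leq_sum => M _.
  case: ifP => //; rewrite -kermx_eq0 => /rowV0Pn [v /sub_kermxP vM v0].
  by rewrite (bigD1 v) //= vM eqxx.
rewrite big_distrl /=; under eq_bigr => v v0 do rewrite card_mulmx_fiber //.
rewrite sum_nat_const leq_mul2r; apply/orP; right.
by apply: leq_trans (max_card _) _; rewrite card_mx mul1n.
Qed.

Lemma row_full_surjective n t (L : 'M[F]_(n, t)) : row_full L -> surjective_lin L.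
Proof.
case/row_fullP => A AL; apply/forallP => y; apply/existsP; exists (y *m A).
by rewrite -mulmxA AL mulmx1.
Qed.

Lemma card_surjective n t : (t < n)%N -> (1 < q)%N ->
  (q ^ (n * t) <= 2 * #|[set L : 'M[F]_(n, t) | surjective_lin L]|)%N.
Proof.
move=> lt q1; have := card_not_row_free t n.
set x := #|_| => hx.
have hy : (q ^ (n * t) <= x + #|[set L : 'M[F]_(n, t) | surjective_lin L]|)%N.
  rewrite -card_mx -cardsT -[X in (X + _)%N](card_imset _ (@trmx_inj F t n)).
  apply: leq_trans (leq_card_setU _ _); apply: subset_leq_card.
  apply/fintype.subsetP => L _; rewrite !inE; apply/orP.
  have [h|h] := boolP (row_free L^T).
    by right; apply: row_full_surjective; rewrite /row_full -mxrank_tr.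
  by left; apply/imsetP; exists L^T; rewrite ?trmxK // inE.
suff : (2 * x <= q ^ (n * t))%N by lia.
have qt : (0 < q ^ t)%N by rewrite expn_gt0 (ltnW q1).
rewrite -(leq_pmul2l qt) (mulnC n) -[leqRHS]mulnC; move: hx; rewrite (mulnC (q ^ t)%N).
apply: leq_trans; rewrite mulnCA mulnA mulnC leq_mul2l; apply/orP; right.
apply: (@leq_trans (q ^ t.+1)%N); first by rewrite expnS leq_mul2r q1 orbT.
by rewrite leq_exp2l.
Qed.

(** Built from the rank factorization of [p]: always invertible and, when [p] is row free, a basis
    that extends the rows of [p]. *)
Definition completion a b (p : 'M[F]_(a, a + b)) : 'M[F]_(a + b) :=
  block_mx (col_ebase p) 0 0 1%:M *m row_ebase p.

Lemma completion_unit a b (p : 'M[F]_(a, a + b)) : completion p \in unitmx.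
Proof.
by rewrite unitmx_mul row_ebase_unit andbT unitmxE det_ublock det1 mulr1 -unitmxE col_ebase_unit.
Qed.

Lemma usubmx_completion a b (p : 'M[F]_(a, a + b)) : row_free p -> usubmx (completion p) = p.
Proof.
move=> /eqP rk; rewrite /completion -mul_usub_mx block_mxEv col_mxKu.
rewrite -[RHS]mulmx_ebase; congr (_ *m _).
by rewrite rk pid_mx_row mul_mx_row mulmx1 mulmx0.
Qed.

End MatrixCounting.

Section Fibers.
Variables (R : realFieldType) (F : finFieldType).
Notation q := #|F|.

Definition fiber_card n k (T : {set 'rV[F]_n}) (C : 'M[F]_(n, k)) (c : 'rV[F]_k) : nat :=
  #|[set x in T | x *m C == c]|.

Lemma sum_fiber_card n k (T : {set 'rV[F]_n}) (C : 'M[F]_(n, k)) :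
  (\sum_c fiber_card T C c = #|T|)%N.
Proof.
rewrite -sum1_card (partition_big (fun x => x *m C) xpredT) //=.
by apply: eq_bigr => c _; rewrite /fiber_card -sum1dep_card.
Qed.

Lemma sum_fiber_card_sqr n k (T : {set 'rV[F]_n}) (C : 'M[F]_(n, k)) :
  (\sum_c fiber_card T C c ^ 2 = \sum_(x in T) \sum_(y in T) (x *m C == y *m C))%N.
Proof.
have E c : fiber_card T C c = (\sum_(x in T) (x *m C == c))%N.
  by rewrite /fiber_card -sum1dep_card big_mkcondr.
under eq_bigr => c _ do rewrite -mulnn E big_distrlr /=.
rewrite exchange_big; apply: eq_bigr => x _ /=.
rewrite exchange_big; apply: eq_bigr => y _ /=.
rewrite (bigD1 (x *m C)) //= eqxx mul1n big1 ?addn0 1?eq_sym //.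
by move=> c ne; rewrite eq_sym (negbTE ne).
Qed.

(* Second moment: distinct points are separated by a uniformly random matrix
   with probability [1 - q^-k]. *)
Lemma fiber_variance n k (T : {set 'rV[F]_n}) :
  \sum_(C : 'M[F]_(n, k)) \sum_c ((fiber_card T C c)%:R - #|T|%:R / (q ^ k)%:R) ^+ 2
    <= (q ^ (n * k))%:R * #|T|%:R :> R.
Proof.
have q0 : (0 < q)%N by apply/card_gt0P; exists 0.
have Q0 : (q ^ k)%:R != 0 :> R by rewrite pnatr_eq0 -lt0n expn_gt0 q0.
set Q : R := (q ^ k)%:R in Q0 *; set X : R := (q ^ (n * k))%:R; set m : R := #|T|%:R.
have cX : (#|{: 'M[F]_(n, k)}|)%:R = X by rewrite card_mx.
have inner (C : 'M[F]_(n, k)) :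
    \sum_c ((fiber_card T C c)%:R - m / Q) ^+ 2 =
    (\sum_c fiber_card T C c ^ 2)%:R - m ^+ 2 / Q.
  under [LHS]eq_bigr => c _ do rewrite sqrrB.
  rewrite !big_split /= sumr_const sumrN sumrMnl -mulr_suml -natr_sum.
  rewrite sum_fiber_card -/m card_mx mul1n natr_sum.
  under [in RHS]eq_bigr => c _ do rewrite natrX.
  rewrite -[(m / Q) ^+ 2 *+ _]mulr_natr -/Q; field.
  exact: Q0.
rewrite (eq_bigr _ (fun C _ => inner C)) big_split /= sumr_const -natr_sum.
have pair (x y : 'rV[F]_n) : (\sum_(C : 'M[F]_(n, k)) (x *m C == y *m C))%:R =
    if x == y then X else X / Q.
  case: eqP => [->|/eqP ne].
    by under eq_bigr => C _ do rewrite eqxx; rewrite sum1_card cX.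
  have := @card_mulmx_fiber F n k (x - y) 0; rewrite subr_eq0 => /(_ ne) /(congr1 (fun i => i%:R : R)).
  rewrite natrM -/X -/Q => <-; rewrite mulfK //; congr (_%:R).
  rewrite -sum1dep_card [RHS]big_mkcond; apply: eq_bigr => C _.
  by rewrite mulmxBl subr_eq0; case: eqP.
have -> : (\sum_(C : 'M[F]_(n, k)) \sum_c fiber_card T C c ^ 2)%:R =
    \sum_(x in T) \sum_(y in T) (if x == y then X else X / Q).
  under eq_bigr => C _ do rewrite sum_fiber_card_sqr.
  rewrite exchange_big natr_sum; apply: eq_bigr => x _ /=.
  by rewrite exchange_big natr_sum; apply: eq_bigr => y _ /=.
have X0 : 0 <= X by exact: ler0n.
have QX : 0 <= X / Q by rewrite divr_ge0 // ler0n.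
(* Each diagonal pair is overcounted by [X / Q]; the pairs then contribute [m^2 X / Q], which the
   squared mean cancels. *)
apply: (@le_trans _ _ (\sum_(x in T) (X + m * (X / Q)) + (- (m ^+ 2 / Q)) *+ #|{: 'M[F]_(n, k)}|)).
  rewrite lerD2r; apply: ler_sum => x xT.
  apply: (@le_trans _ _ (\sum_(y in T) ((if x == y then X else 0) + X / Q))).
    by apply: ler_sum => y _; case: eqP => _; rewrite ?lerDl ?add0r.
  rewrite big_split /= sumr_const -[_ *+ #|T|]mulr_natl -/m lerD2r -big_mkcondr.
  rewrite (bigD1 x) /= ?xT ?eqxx // big1 ?addr0 // => y.
  by rewrite eq_sym => /andP[/andP[_ /eqP ->]]; rewrite eqxx.
rewrite sumr_const -[leLHS]/(_ *+ _ + _ *+ _) -[_ *+ #|T|]mulr_natr -[_ *+ #|{: 'M[F]_(n, k)}|]mulr_natr cX -/m.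
rewrite le_eqVlt; apply/orP; left; apply/eqP.
by field.
Qed.

End Fibers.

(* Among the sets [R x], each point being covered by at least a proportion
   [a] of them, a greedy choice covers half of [D] at a cost proportional to [c/a]. *)
Lemma greedy_cover (R : realFieldType) (X D Y : finType) (D0 : {set D})
    (cov : X -> {set D}) (B : X -> {set Y}) (a c : R) :
  0 < a -> 0 < c ->
  (forall p, p \in D0 -> a * #|X|%:R <= #|[set x | p \in cov x]|%:R) ->
  \sum_x #|B x|%:R < c * #|X|%:R ->
  exists T : {set X},
    (#|D0| <= 2 * #|[set p in D0 | [exists x in T, p \in cov x]]|)%N /\
    a * #|[set y | [exists x in T, y \in B x]]|%:R <= 2 * c.
Proof.
move=> a0 c0 hcov hB.
pose CV (T : {set X}) := [set p in D0 | [exists x in T, p \in cov x]].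
pose BB (T : {set X}) := [set y | [exists x in T, y \in B x]].
(* The cost per covered element stays at most [2c / (a #|D0|)]; [T] is chosen with maximal coverage
   under this constraint. *)
pose inv (T : {set X}) := a * #|D0|%:R * #|BB T|%:R <= 2 * c * #|CV T|%:R.
have [D00|D0gt] := posnP #|D0|.
  exists finset.set0; rewrite D00; split=> //.
  rewrite (_ : [set y | _] = finset.set0) ?cards0 ?mulr0; first by rewrite mulr_ge0 // ltW.
  by apply/setP => y; rewrite !inE; apply/existsP => -[x]; rewrite inE.
have inv0 : inv finset.set0.
  rewrite /inv (_ : BB _ = finset.set0) ?cards0 ?mulr0; last first.
    by apply/setP => y; rewrite !inE; apply/existsP => -[x]; rewrite inE.
  by rewrite mulr_ge0 // mulr_ge0 // ltW.
case: (arg_maxnP (P := inv) (fun T => #|CV T|) inv0) => T invT maxT.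
exists T; rewrite -/(CV T) -/(BB T).
have half : (#|D0| <= 2 * #|CV T|)%N.
  rewrite leqNgt; apply/negP => lt.
  pose U := D0 :\: CV T.
  have subCV : CV T \subset D0 by apply/fintype.subsetP => p; rewrite inE => /andP[].
  have cU : (#|D0| = #|U| + #|CV T|)%N by rewrite addnC -(cardsID (CV T) D0) (finset.setIidPr subCV).
  have U0 : (0 < #|U|)%N by lia.
  (* By averaging, some [x] costs less than [c / (a #|U|)] per newly covered element. While less
     than half of [D0] is covered, [#|U| >= #|D0| / 2], so adding [x] preserves [inv]; strictness
     makes the gain positive. *)
  have [x hx] : exists x, a * #|U|%:R * #|B x|%:R < c * #|cov x :&: U|%:R.
    apply/existsP; apply: contraLR hB => /existsPn h; rewrite -leNgt.
    have aU : 0 < a * #|U|%:R by rewrite mulr_gt0 ?ltr0n.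
    rewrite -(ler_pM2l aU) mulr_sumr.
    apply: (@le_trans _ _ (\sum_x c * #|cov x :&: U|%:R)); last first.
      by apply: ler_sum => x _; rewrite leNgt h.
    rewrite -mulr_sumr mulrCA ler_pM2l // -natr_sum.
    have -> : (\sum_x #|cov x :&: U| = \sum_(p in U) #|[set x | p \in cov x]|)%N.
      under eq_bigr => x _ do
        rewrite -sum1_card (eq_bigl _ _ (fun p => finset.in_setI p _ _)).
      rewrite (exchange_big_dep (mem U)) /=; last by move=> ? ? _ /andP[].
      by apply: eq_bigr => p pU; rewrite -sum1dep_card; apply: eq_bigl => x; rewrite pU andbT.
    rewrite natr_sum mulrAC mulrC -[leLHS]mulrC mulr_natr -sumr_const; apply: ler_sum => p.
    by rewrite !inE => /andP[_ pD]; apply: hcov.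
  have card1 : (#|CV T| + #|cov x :&: U| <= #|CV (x |: T)|)%N.
    have dis : [disjoint CV T & cov x :&: U].
      rewrite -setI_eq0; apply/eqP/setP => p; rewrite !inE.
      by case: (p \in D0) => //=; case: [exists _ in _, _]; rewrite ?andbF.
    have /eqP <- : #|CV T :|: (cov x :&: U)| == (#|CV T| + #|cov x :&: U|)%N.
      by rewrite (leq_card_setU _ _).2.
    apply: subset_leq_card; apply/fintype.subsetP => p.
    rewrite !inE => /orP[/andP[-> /existsP [y /andP[yT py]]]|/andP[px /andP[_ ->]]] /=.
      by apply/existsP; exists y; rewrite !inE yT orbT.
    by apply/existsP; exists x; rewrite !inE eqxx.
  have card2 : (#|BB (x |: T)| <= #|BB T| + #|B x|)%N.
    apply: leq_trans (leq_card_setU _ _); apply: subset_leq_card.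
    apply/fintype.subsetP => y; rewrite !inE => /existsP [z]; rewrite !inE.
    case/andP => /orP[/eqP ->|zT] yz; first by rewrite yz orbT.
    by apply/orP; left; apply/existsP; exists z; rewrite zT.
  have pos : (0 < #|cov x :&: U|)%N.
    rewrite -(ltr0n R) -(pmulr_rgt0 _ c0); apply: le_lt_trans hx.
    by rewrite mulr_ge0 // mulr_ge0 // ltW.
  have := maxT (x |: T); rewrite /inv => h.
  suff /h : a * #|D0|%:R * #|BB (x |: T)|%:R <= 2 * c * #|CV (x |: T)|%:R.
    by move: pos card1; clear; lia.
  have DU : #|D0|%:R <= 2 * #|U|%:R :> R.
    by rewrite -natrM ler_nat; move: lt; rewrite cU; clear; lia.
  apply: (@le_trans _ _ (a * #|D0|%:R * (#|BB T| + #|B x|)%:R)).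
    by rewrite ler_wpM2l ?ler_nat // mulr_ge0 // ltW.
  apply: (@le_trans _ _ (2 * c * (#|CV T| + #|cov x :&: U|)%:R)); last first.
    by rewrite ler_wpM2l ?ler_nat // mulr_ge0 // ltW.
  rewrite !natrD !mulrDr lerD //.
  apply: (@le_trans _ _ (2 * (a * #|U|%:R * #|B x|%:R))).
    rewrite !mulrA ler_wpM2r // (mulrC 2) -mulrA ler_wpM2l // ltW //.
  by rewrite -[leRHS]mulrA ler_wpM2l // ltW.
split=> //; have D1 : 0 < #|D0|%:R :> R by rewrite ltr0n.
rewrite -(ler_pM2r D1) mulrAC; apply: le_trans invT _.
apply: ler_wpM2l; first by rewrite mulr_ge0 // ltW.
rewrite ler_nat.
by apply: subset_leq_card; apply/fintype.subsetP => p; rewrite inE => /andP[].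
Qed.

(** * Abnormal fibers and Chebyshev's inequality *)

Section Deviation.
Variables (R : realFieldType) (F : finFieldType).
Notation q := #|F|.

(** The threshold is half of an imbalance [tau * mu]; the other half is spent in a triangle
    inequality. *)
Definition deviant (tau mu : R) n k (T : {set 'rV[F]_n}) (C : 'M[F]_(n, k)) : {set 'rV[F]_k} :=
  [set c | tau * mu / 2 < `|(fiber_card T C c)%:R - mu|].

(** With [h = s - tau * mu], the square is [(tau * mu / 2 + h)^2], whose expansion is compared term
    by term. *)
Lemma deviation_sqr_ge (n tau mu s : R) : 0 <= n -> 0 < tau -> 0 < mu ->
  32 * n * (1 + tau) <= mu * tau ^+ 2 -> tau * mu <= s ->
  8 * n * (mu + s) <= (s - tau * mu / 2) ^+ 2.
Proof.
move=> n0 t0 m0 hyp les; pose h := s - tau * mu.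
have h0 : 0 <= h by rewrite subr_ge0.
have key1 : 8 * n * (1 + tau) * mu <= tau ^+ 2 * mu ^+ 2 / 4.
  by have := ler_wpM2r (ltW m0) hyp; lra.
have key2 : 32 * n <= mu * tau.
  rewrite -(ler_pM2r t0) -[leRHS]mulrA -expr2; apply: (le_trans _ hyp).
  by have := mulr_ge0 n0 (ltW t0); lra.
have key3 : 8 * n * h <= mu * tau * h by apply: ler_wpM2r => //; lra.
have -> : s = tau * mu + h by rewrite /h; lra.
have h2 := sqr_ge0 h.
rewrite (_ : (_ - _) ^+ 2 = tau ^+ 2 * mu ^+ 2 / 4 + mu * tau * h + h ^+ 2); last by field.
rewrite (_ : 8 * n * _ = 8 * n * (1 + tau) * mu + 8 * n * h); last by ring.
by rewrite -[leLHS]addr0 lerD // lerD.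
Qed.

(* Chebyshev over the choice of two further coordinates: when the fiber [T] has
   an abnormal size, most cells of a random splitting of [T] into [q^2] cells are
   abnormal as well. *)
Lemma card_many_deviant n m (T : {set 'rV[F]_n}) (tau mu : R) :
  (0 < m)%N -> 0 < tau -> 0 < mu ->
  32 * m%:R * (1 + tau) <= mu * tau ^+ 2 ->
  tau * mu <= `|#|T|%:R / (q ^ 2)%:R - mu| ->
  (q ^ (n * 2) <= 2 * #|[set C : 'M[F]_(n, 2) |
      (4 * m - 1) * q ^ 2 <= 4 * m * #|deviant tau mu T C|]|)%N.
Proof.
move=> m0 t0 mu0 hyp; set nu := _ / _; set s := `|_| => les.
have q0 : (0 < q ^ 2)%N by rewrite expn_gt0; apply/orP; left; apply/card_gt0P; exists 0.
set good := [set C | _].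
have := deviation_sqr_ge (ler0n _ m) t0 mu0 hyp les.
set theta := s - _ => hth.
have th0 : 0 < theta by rewrite /theta; have := mulr_gt0 t0 mu0; lra.
have nule : nu <= mu + s by rewrite /s; have := ler_norm (nu - mu); lra.
have Tq : #|T|%:R = nu * (q ^ 2)%:R by rewrite /nu divfK // pnatr_eq0 -lt0n.
have X0 : 0 <= (q ^ (n * 2))%:R :> R by exact: ler0n.
have var := fiber_variance R 2 T.
have bad : 2 * #|~: good|%:R <= (q ^ (n * 2))%:R :> R.
  (* A bad [C] has at least [q^2 / (4m)] cells that are not deviant, each at distance at least
     [theta] from the mean [nu]. *)
  have each C : C \in ~: good ->
      theta ^+ 2 * (q ^ 2)%:R <= 4 * m%:R * \sum_c ((fiber_card T C c)%:R - nu) ^+ 2.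
    rewrite !inE -ltnNge => lt.
    have cC : (q ^ 2 <= 4 * m * #|~: deviant tau mu T C|)%N.
      have := cardsC (deviant tau mu T C); rewrite card_mx mul1n.
      by move: lt; move: #|deviant _ _ _ _| #|~: _| (q ^ 2)%N m0; clear; nia.
    apply: (@le_trans _ _ (theta ^+ 2 * (4 * m * #|~: deviant tau mu T C|)%:R)).
      by rewrite ler_wpM2l ?sqr_ge0 ?ler_nat.
    rewrite !natrM mulrCA; apply: ler_wpM2l; first by rewrite mulr_ge0.
    rewrite (bigID (mem (deviant tau mu T C))) /= addrC.
    apply: (@le_trans _ _ (\sum_(c | c \notin deviant tau mu T C) theta ^+ 2)).
      rewrite sumr_const mulr_natr le_eqVlt; apply/orP; left; apply/eqP; congr (_ *+ _).
      by apply: eq_card => c; rewrite finset.in_setC.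
    apply: ler_wpDr; first by apply: sumr_ge0 => c _; apply: sqr_ge0.
    apply: ler_sum => c; rewrite inE -leNgt => dc.
    rewrite -[leRHS](real_normK (num_real _)) ler_pXn2r ?nnegrE ?(ltW th0) //.
    have : s <= `|(fiber_card T C c)%:R - nu| + `|(fiber_card T C c)%:R - mu|.
      by rewrite /s (distrC _ nu); apply: ler_distD.
    by rewrite /theta; lra.
  have : theta ^+ 2 * (q ^ 2)%:R * #|~: good|%:R <= 4 * m%:R * ((q ^ (n * 2))%:R * #|T|%:R).
    rewrite mulr_natr -sumr_const.
    apply: (@le_trans _ _ (\sum_(C in ~: good)
      4 * m%:R * \sum_c ((fiber_card T C c)%:R - nu) ^+ 2)); first exact: ler_sum.
    rewrite -mulr_sumr; apply: ler_wpM2l; first by rewrite mulr_ge0.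
    apply: (le_trans _ var).
    rewrite [leRHS](bigID (mem (~: good))) /= lerDl.
    by apply: sumr_ge0 => C _; apply: sumr_ge0 => c _; apply: sqr_ge0.
  rewrite Tq => le1.
  have Q0 : 0 < (q ^ 2)%:R :> R by rewrite ltr0n.
  rewrite -(ler_pM2l (mulr_gt0 (exprn_gt0 2 th0) Q0)).
  apply: (@le_trans _ _ (2 * (4 * m%:R * ((q ^ (n * 2))%:R * (nu * (q ^ 2)%:R))))); first by lra.
  rewrite (_ : _ * _ = 8 * m%:R * nu * ((q ^ (n * 2))%:R * (q ^ 2)%:R)); last by ring.
  rewrite -[leRHS]mulrA [X in _ <= _ * X]mulrC ler_wpM2r ?mulr_ge0 //.
  by apply: (le_trans _ hth); rewrite ler_wpM2l ?mulr_ge0.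
have := cardsC good; rewrite card_mx => cg.
move: bad cg; rewrite -natrM ler_nat.
move: #|good| #|~: good| (q ^ (n * 2))%N; clear; lia.
Qed.

Lemma fiber_card_row_mx n k t (S : {set 'rV[F]_n}) (C : 'M[F]_(n, k)) (L : 'M[F]_(n, t)) c y :
  fiber_card S (row_mx C L) (row_mx c y) = fiber_card [set x in S | x *m L == y] C c.
Proof.
apply: eq_card => x; rewrite !inE mul_mx_row -andbA; congr (_ && _).
by apply/eqP/andP => [/eq_row_mx [-> ->]|[/eqP -> /eqP ->]].
Qed.

Lemma fiber_card_mulmx n k (S : {set 'rV[F]_n}) (A : 'M[F]_(n, k)) (M : 'M[F]_k) c :
  M \in unitmx -> fiber_card S A (c *m M) = fiber_card S (A *m invmx M) c.
Proof.
move=> uM; apply: eq_card => x; rewrite !inE mulmxA; congr (_ && _).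
apply/eqP/eqP => [->|<-]; first by rewrite mulmxK.
by rewrite mulmxKV.
Qed.

(** Markov's inequality: each deviant point contributes more than [(tau * mu / 2)^2] to the sum in
    [fiber_variance]. *)
Lemma sum_card_deviant n k (S : {set 'rV[F]_n}) (tau mu : R) :
  0 < tau -> 0 < mu -> mu = #|S|%:R / (q ^ k)%:R ->
  tau ^+ 2 * mu * (\sum_(A : 'M[F]_(n, k)) #|deviant tau mu S A|)%:R
    <= 4 * (q ^ (n * k))%:R * (q ^ k)%:R.
Proof.
move=> t0 mu0 muE.
have Q0 : (q ^ k)%:R != 0 :> R.
  by rewrite pnatr_eq0 -lt0n expn_gt0; apply/orP; left; apply/card_gt0P; exists 0.
have Sq : #|S|%:R = mu * (q ^ k)%:R by rewrite muE divfK.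
have var := fiber_variance R k S.
rewrite -(ler_pM2l mu0).
apply: (@le_trans _ _ (4 * \sum_(A : 'M[F]_(n, k)) \sum_c
    ((fiber_card S A c)%:R - #|S|%:R / (q ^ k)%:R) ^+ 2)); last first.
  by move: var; rewrite Sq; lra.
rewrite -muE natr_sum !mulr_sumr; apply: ler_sum => A _.
rewrite (bigID (mem (deviant tau mu S A))) /=.
apply: (@le_trans _ _ (4 * \sum_(c in deviant tau mu S A) (tau * mu / 2) ^+ 2)).
  by rewrite sumr_const -mulr_natr le_eqVlt; apply/orP; left; apply/eqP; field.
apply: ler_wpM2l => //; apply: ler_wpDr; first by apply: sumr_ge0 => c _; apply: sqr_ge0.
apply: ler_sum => c; rewrite inE => dc.
rewrite -[leRHS](real_normK (num_real _)) ler_pXn2r ?nnegrE ?(ltW dc) //.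
by rewrite divr_ge0 // mulr_ge0 // ltW.
Qed.

End Deviation.

(** * Unbalanced maps *)

Section UnbalancedMaps.
Variables (R : realFieldType) (F : finFieldType) (n t : nat) (S : {set 'rV[F]_n}).
Variables (tau mu : R).
Notation q := #|F|.

(* A coset of the first two coordinates is the family of cells into which the
   fiber over [y] of the last [t] coordinates of the map is split. *)
Definition planar_deviant : {set 'M[F]_(n, 2 + t)} :=
  [set M | [exists y : 'rV[F]_t, ((4 * n - 1) * q ^ 2 <=
     4 * n * #|[set c : 'rV[F]_2 | row_mx c y \in deviant tau mu S M]|)%N]].

(** By [card_many_deviant], half of the extensions [row_mx C L] of each bad [L] are planar deviant,
    and extensions of different [L] are distinct. *)
Lemma card_planar_deviant (Bad : {set 'M[F]_(n, t)}) :
  (0 < n)%N -> 0 < tau -> 0 < mu -> 32 * n%:R * (1 + tau) <= mu * tau ^+ 2 ->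
  (forall L, L \in Bad -> exists y,
     tau * (mu * (q ^ 2)%:R) < `|(fiber_card S L y)%:R - mu * (q ^ 2)%:R|) ->
  (q ^ (n * 2) * #|Bad| <= 2 * #|planar_deviant|)%N.
Proof.
move=> n0 t0 m0 hyp HB.
have Q0 : 0 < (q ^ 2)%:R :> R.
  by rewrite ltr0n expn_gt0; apply/orP; left; apply/card_gt0P; exists 0.
pose ext L := [set C : 'M[F]_(n, 2) | row_mx C L \in planar_deviant].
have each L : L \in Bad -> (q ^ (n * 2) <= 2 * #|ext L|)%N.
  case/HB => y hy; pose T := [set x in S | x *m L == y].
  have dev : tau * mu <= `|#|T|%:R / (q ^ 2)%:R - mu|.
    have -> : #|T|%:R / (q ^ 2)%:R - mu = (#|T|%:R - mu * (q ^ 2)%:R) / (q ^ 2)%:R.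
      by rewrite mulrBl mulfK ?gt_eqF.
    by rewrite normrM normfV (gtr0_norm Q0) ler_pdivlMr // -mulrA ltW.
  apply: leq_trans (card_many_deviant n0 t0 m0 hyp dev) _.
  rewrite leq_mul2l; apply: subset_leq_card; apply/fintype.subsetP => C.
  rewrite [C \in ext L]inE [row_mx C L \in _]inE inE => hC; apply/existsP; exists y.
  apply: leq_trans hC _; rewrite leq_mul2l; apply/orP; right.
  by apply: subset_leq_card; apply/fintype.subsetP => c; rewrite !inE fiber_card_row_mx.
have sumext : (\sum_(L in Bad) #|ext L| <= #|planar_deviant|)%N.
  rewrite -[leqRHS]sum1_card (partition_big (@rsubmx F n 2 t) xpredT) //=.
  rewrite big_mkcond; apply: leq_sum => L _; case: ifP => // _.
  rewrite -(card_imset _ (f := fun C : 'M[F]_(n, 2) => row_mx C L)); last first.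
    by move=> C C' /eq_row_mx [].
  rewrite sum1dep_card; apply: subset_leq_card; apply/fintype.subsetP => M.
  by case/imsetP => C hC ->; move: hC; rewrite !finset.in_set row_mxKr eqxx andbT.
rewrite mulnC -sum_nat_const; apply: (@leq_trans (\sum_(L in Bad) 2 * #|ext L|)%N).
  exact: leq_sum.
by rewrite -big_distrr leq_mul2l sumext.
Qed.

Definition planar_directions (M : 'M[F]_(n, 2 + t)) : {set 'M[F]_(2, 2 + t)} :=
  [set p | row_free p & M *m invmx (completion p) \in planar_deviant].

(** The change of basis [completion p] turns a coset of the first two coordinates into a translate
    of the plane spanned by [p]. *)
Lemma planar_directionsP M p : p \in planar_directions M ->
  exists a : 'rV[F]_(2 + t), ((4 * n - 1) * q ^ 2 <=
    4 * n * #|[set c : 'rV[F]_2 | (a + c *m p)%R \in deviant tau mu S M]|)%N.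
Proof.
rewrite inE => /andP[fp]; rewrite inE => /existsP [y hy].
exists (y *m dsubmx (completion p)); apply: leq_trans hy _.
rewrite leq_mul2l; apply/orP; right; apply: subset_leq_card; apply/fintype.subsetP => c.
have E : y *m dsubmx (completion p) + c *m p = row_mx c y *m completion p.
  rewrite -[in RHS](vsubmxK (completion p)) mul_row_col usubmx_completion //.
  exact: addrC.
by rewrite !inE E fiber_card_mulmx ?completion_unit.
Qed.

(** Multiplication by [completion p] permutes the maps, so every direction is covered equally
    often. *)
Lemma card_planar_directions p : row_free p ->
  #|[set M | p \in planar_directions M]| = #|planar_deviant|.
Proof.
move=> fp; have u := completion_unit p.
rewrite -[RHS](card_imset _ (can_inj (mulmxK u))); apply: eq_card => M.
rewrite !inE fp /=; apply/idP/imsetP => [h|[M' h ->]].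
  by exists (M *m invmx (completion p)); rewrite ?inE // mulmxKV.
by rewrite mulmxK //; rewrite inE in h.
Qed.

(** At most a proportion [1/q <= 1/4] is rank deficient. Half of the row free matrices then exceed
    the third that [kakeya_planes] needs. *)
Lemma card_row_free_ge N : (2 < N)%N -> (3 < q)%N ->
  (2 * q ^ (2 * N) < 3 * #|[set p : 'M[F]_(2, N) | row_free p]|)%N.
Proof.
move=> N2 q3; have := card_not_row_free F 2 N.
have := cardsC [set p : 'M[F]_(2, N) | row_free p]; rewrite card_mx.
have -> : ~: [set p : 'M[F]_(2, N) | row_free p] = [set p | ~~ row_free p].
  by apply/setP => p; rewrite !inE.
have q0 : (0 < q)%N by lia.
have : (q ^ 3 <= q ^ N)%N by rewrite leq_exp2l //; lia.
rewrite (expnS _ 2); have : (0 < q ^ 2)%N by rewrite expn_gt0 q0.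
have : (0 < q ^ (2 * N))%N by rewrite expn_gt0 q0.
move: (q ^ (2 * N))%N (q ^ N)%N (q ^ 2)%N #|_| #|_| => x y z g f x0 z0 le e h.
have : (z * (q * g) <= z * x)%N.
  by apply: leq_trans h; rewrite mulnA (mulnC z) (mulnC g) leq_mul2r le orbT.
rewrite leq_pmul2l // => h1.
have h2 : (4 * g <= x)%N by apply: leq_trans h1; rewrite leq_mul2r q3 orbT.
by move: x0 e h2; clear; lia.
Qed.

End UnbalancedMaps.

Theorem card_unbalanced (R : realFieldType) (F : finFieldType) (n t : nat)
    (S : {set 'rV[F]_n}) (tau delta mu : R) (Bad : {set 'M[F]_(n, t)}) :
  (0 < t)%N -> (2 + t <= n)%N -> 0 < tau -> 0 < delta -> delta < 1 ->
  (32 * n <= #|F|)%N -> 32 * n%:R * (1 + tau) <= #|F|%:R * (tau * delta) ^+ 2 ->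
  mu = #|S|%:R / (#|F| ^ (2 + t))%:R -> #|F|%:R < mu ->
  (forall L, L \in Bad -> exists y,
     tau * (mu * (#|F| ^ 2)%:R) < `|(fiber_card S L y)%:R - mu * (#|F| ^ 2)%:R|) ->
  2 * #|Bad|%:R <= delta * (#|F| ^ (n * t))%:R.
Proof.
move=> t1 leN t0 d0 d1 leq hyp muE ltmu HBad; rewrite leNgt; apply/negP => big.
have n1 : (2 < n)%N by move: t1 leN; clear; lia.
have n0 : (0 < n)%N by apply: ltn_trans n1.
have Fgt0 : (0 < #|F|)%N by move: leq n0; clear; lia.
have F3 : (3 < #|F|)%N by move: leq n0; clear; lia.
have qn0 : 0 < #|F|%:R :> R by rewrite ltr0n.
have mu0 : 0 < mu by apply: lt_trans ltmu.
set q : R := #|F|%:R in hyp ltmu qn0 *.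
have tt0 : 0 < tau ^+ 2 by rewrite exprn_gt0.
have dd1 : delta ^+ 2 <= delta by rewrite expr2 ler_piMr // ltW.
have hyp' : 32 * n%:R * (1 + tau) <= mu * tau ^+ 2.
  apply: le_trans hyp _; rewrite exprMn mulrA.
  apply: (@le_trans _ _ (q * tau ^+ 2 * 1)).
    by rewrite ler_pM2l ?mulr_gt0 // (le_trans dd1) // ltW.
  by rewrite mulr1 ler_pM2r // ltW.
pose E := planar_deviant t S tau mu.
(* More than [delta / 2] of the maps are bad, and half of their extensions count. *)
have cE : delta / 4 * (#|F| ^ (n * (2 + t)))%:R <= #|E|%:R.
  have := card_planar_deviant n0 t0 mu0 hyp' HBad; rewrite -(ler_nat R) !natrM -/E => h.
  rewrite mulnDr expnD natrM; set X := (_ ^ (n * 2))%:R in h *.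
  have X0 : 0 <= X by exact: ler0n.
  have := ler_wpM2l X0 (ltW big); lra.
set QN : R := (#|F| ^ (2 + t))%:R.
have QN0 : 0 < QN by rewrite ltr0n expn_gt0 Fgt0.
(* Strict upper bound for the mean size of a deviant set, by [sum_card_deviant] and [q < mu]. *)
pose c := 4 * QN / (tau ^+ 2 * q).
have c0 : 0 < c by rewrite divr_gt0 ?mulr_gt0.
have X0 : 0 < (#|F| ^ (n * (2 + t)))%:R :> R.
  by rewrite ltr0n expn_gt0 Fgt0.
have [||T [half cost]] := @greedy_cover R 'M[F]_(n, 2 + t) 'M[F]_(2, 2 + t) 'rV[F]_(2 + t)
  [set p | row_free p] (planar_directions S tau mu) (deviant tau mu S)
  (delta / 4) c (divr_gt0 d0 (ltr0n _ 4)) c0.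
- by move=> p; rewrite inE => fp; rewrite card_mx card_planar_directions.
- rewrite card_mx -natr_sum.
  have := sum_card_deviant t0 mu0 muE; set Y := _%:R => h.
  have tm : 0 < tau ^+ 2 * mu by rewrite mulr_gt0.
  rewrite -(ltr_pM2l tm); apply: le_lt_trans h _.
  rewrite (_ : _ * (c * _) = mu / q * (4 * (#|F| ^ (n * (2 + t)))%:R * QN)); last first.
    by rewrite /c; field; rewrite ?gt_eqF.
  by rewrite ltr_pMl ?mulr_gt0 // ltr_pdivlMr // mul1r.
set G := [set p in _ | _] in half; set B := [set y | _] in cost.
have kak : (#|F| ^ (2 + t) <= 2 * #|B|)%N.
  apply: (@kakeya_planes F (2 + t) n B G) => //; first exact: ltnW.
    have := @card_row_free_ge F (2 + t) _ _; rewrite !ltnS.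
    move=> /(_ t1 F3) h; rewrite -(ltn_pmul2l (isT : 0 < 2)%N); apply: leq_trans h _.
    by rewrite [leqRHS]mulnCA leq_mul2l half.
  move=> p; rewrite inE => /andP[_ /existsP [M /andP[MT /planar_directionsP [a ha]]]].
  exists a; apply: leq_trans ha _; rewrite leq_mul2l; apply/orP; right.
  apply: subset_leq_card; apply/fintype.subsetP => x; rewrite !inE => hx.
  by apply/existsP; exists M; rewrite MT inE.
have kakR : QN <= 2 * #|B|%:R by rewrite -natrM ler_nat.
(* Combining [QN <= 2 #|B|] with the cost bound gives [q (tau delta)^2 <= 64], whereas the
   hypothesis and [n >= 3] give at least 96. *)
have le1 : delta * QN <= 16 * c.
  have := ler_wpM2l (ltW d0) kakR; lra.
have tq : 0 < tau ^+ 2 * q by rewrite mulr_gt0.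
have le2 : delta * (tau ^+ 2 * q) <= 64.
  rewrite -(ler_pM2r QN0); move: le1; rewrite /c mulrA ler_pdivlMr //; lra.
have le3 : q * (tau * delta) ^+ 2 <= delta * (tau ^+ 2 * q).
  rewrite exprMn (_ : q * _ = delta ^+ 2 * (tau ^+ 2 * q)); last by ring.
  by rewrite ler_pM2r.
have n3 : 3 <= n%:R :> R by rewrite ler_nat.
have := mulr_ge0 (ler0n R n) (ltW t0); lra.
Qed.

(** * From all linear maps to the surjective ones *)

Theorem mainTheorem1 (R : realType) (F : finFieldType) (n r : nat)
  (S : {set 'rV[F]_n}) (tau delta : R) :
  (5 <= n)%N ->
  0 < tau -> 0 < delta -> delta < 1 ->
  (#|F|%:R : R) >= 32 * Num.max ((n%:R * (1 + tau)) / (tau * delta) ^+ 2) n%:R ->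
  (4 <= r)%N -> (r <= n.-1)%N ->
  (#|F| ^ r < #|S|)%N -> (#|S| <= #|F| ^ r.+1)%N ->
  (1 - delta) * (#|[set L : 'M[F]_(n, r - 3) | surjective_lin L]|%:R)
    <= (#|[set L : 'M[F]_(n, r - 3) | surjective_lin L &
           `[< close_to_uniform S L (tau / (#|F| ^ (r - 3))%:R) >] ]|%:R).
Proof.
move=> n5 t0 d0 d1 hq r4 rn Slt _.
have [t rE] : exists t, r = (t + 3)%N by exists (r - 3)%N; lia.
rewrite rE addnK in r4 rn Slt *.
set surj := [set L | surjective_lin L]; set good := [set L | _].
have leq32 : (32 * n <= #|F|)%N.
  rewrite -(ler_nat R) natrM; apply: le_trans hq.
  by rewrite ler_pM2l // le_max lexx orbT.
have hyp : 32 * n%:R * (1 + tau) <= #|F|%:R * (tau * delta) ^+ 2.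
  have td : 0 < (tau * delta) ^+ 2 by rewrite exprn_gt0 // mulr_gt0.
  rewrite -ler_pdivrMr //; apply: le_trans hq.
  by rewrite -!mulrA ler_pM2l // mulrA le_max lexx.
have q1 : (1 < #|F|)%N by lia.
have Qgt0 k : 0 < (#|F| ^ k)%:R :> R by rewrite ltr0n expn_gt0; apply/orP; left; lia.
have S0 : 0 < #|S|%:R :> R by rewrite ltr0n; lia.
pose mu : R := #|S|%:R / (#|F| ^ (2 + t))%:R.
(* Since [r = t + 3], the target of dimension [t + 2] has [q^(r-1)] points, hence mean fibers larger
   than [q]. *)
have qmu : #|F|%:R < mu.
  rewrite /mu ltr_pdivlMr // -natrM ltr_nat; apply: leq_ltn_trans Slt.
  by rewrite -expnS leq_exp2l //; lia.
have muq : mu * (#|F| ^ 2)%:R = #|S|%:R / (#|F| ^ t)%:R.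
  rewrite /mu expnD natrM -mulrA; congr (_ * _).
  by rewrite invfM mulrAC mulVf ?mul1r ?gt_eqF.
pose Bad := surj :\: good.
have HBad L : L \in Bad -> exists y,
    tau * (mu * (#|F| ^ 2)%:R) < `|(fiber_card S L y)%:R - mu * (#|F| ^ 2)%:R|.
  rewrite !inE => /andP[+ sL]; rewrite sL /= => /asboolPn /existsNP [y hy].
  exists y; move/negP: hy; rewrite -ltNge /prob_img card_mx mul1n muq => hy.
  have -> : (fiber_card S L y)%:R - #|S|%:R / (#|F| ^ t)%:R =
     #|S|%:R * ((fiber_card S L y)%:R / #|S|%:R - (#|F| ^ t)%:R^-1) :> R.
    by rewrite mulrBr mulrCA mulfV ?mulr1 ?gt_eqF.
  by rewrite normrM (gtr0_norm S0) mulrCA ltr_pM2l.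
(* The bad maps are at most [delta / 2] of all maps; since at least half of all maps are surjective,
   they are at most [delta] of the surjective ones. *)
have bad : 2 * #|Bad|%:R <= delta * (#|F| ^ (n * t))%:R.
  by apply: (card_unbalanced _ _ t0 d0 d1 leq32 hyp _ qmu HBad) => //; lia.
have := @card_surjective F n t _ q1; rewrite -/surj => /(_ _) cs.
have {}cs : (#|F| ^ (n * t))%:R <= 2 * #|surj|%:R :> R.
  by rewrite -natrM ler_nat; apply: cs; lia.
have := ler_wpM2l (ltW d0) cs.
have cB : #|surj|%:R = #|good|%:R + #|Bad|%:R :> R.
  rewrite -natrD -(cardsID good surj); congr (_ + _)%:R; apply: eq_card => L.
  by rewrite !inE andbA andbb.
rewrite cB; lra.
Qed.
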